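(* Let $G$ be a locally compact group, let $K_j\in\mathcal{K}(G)$ and $\rho_j\in\widehat{(K_j)}_1$ for $j=1,\dots,m$, and suppose that $L=\langle K_1\cdots K_m\rangle\in\mathcal{K}(G)$. Then the weak* limit \[ \lim_{n\to\infty}\left[(\rho_1 m_{K_1})\ast\cdots\ast(\rho_m m_{K_m})\right]^{\ast n} \] always exists. It is $\rho m_L$, provided there is a $\rho\in\widehat{L}_1$ for which $\rho|_{K_j}=\rho_j$ for each $j$, and it is $0$ otherwise.
   Context: $\mathrm{M}(G)$ denotes the measure algebra of $G$: the complex (finite, regular) Borel measures on $G$, identified with the dual of $\mathcal{C}_0(G)$ (the weak* topology is with respect to this duality), with convolution $\ast$ as product; $\mu^{\ast n}$ is the $n$-fold convolution power. $\mathcal{K}(G)$ denotes the collection of all compact subgroups of $G$. For $K\in\mathcal{K}(G)$, $m_K$ is the normalised Haar measure on $K$, regarded as an element of $\mathrm{M}(G)$, and $\widehat{K}_1$ is the set of multiplicative characters of $K$, i.e. continuous homomorphisms $K\to\mathbb{T}=\{z\in\mathbb{C}:|z|=1\}$. For $\rho\in\widehat{K}_1$ the measure $\rho m_K\in\mathrm{M}(G)$ is given by $\int_G u\,d(\rho m_K)=\int_K u(k)\rho(k)\,dm_K(k)$ for $u\in\mathcal{C}_0(G)$. For a subset $S\subseteq G$, $\langle S\rangle$ is the smallest closed subgroup of $G$ containing $S$. $K_1\cdots K_m=\{k_1\cdots k_m:k_j\in K_j\}$. *)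

(* Defs.v *)
From HB Require Import structures.
From mathcomp Require Import all_boot all_order all_algebra.
From mathcomp Require Import all_classical all_reals all_analysis.
From mathcomp Require Import complex.

Set Implicit Arguments.
Unset Strict Implicit.
Unset Printing Implicit Defensive.

Import Order.TTheory GRing.Theory Num.Theory numFieldNormedType.Exports.

Local Open Scope classical_set_scope.
Local Open Scope ring_scope.
Local Open Scope complex_scope.

(* The usual topology of the complex numbers: the one of the norm of [R[i]]. *)
#[export, non_forgetful_inheritance]
HB.instance Definition _ (R : rcfType) :=
  PseudoPointedMetric.copy R[i] (R[i])^o.
#[export, non_forgetful_inheritance]
HB.instance Definition _ (R : rcfType) := NormedModule.copy R[i] (R[i])^o.

(* Locally compact groups are Hausdorff, as usual.  The distinguished point
   is not required to be the identity; it is only there because measurable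
   types are pointed. *)
HB.mixin Record isLCGroup G & PointedTopological G & Group G := {
  mulg_continuous : continuous (fun p : G * G => (p.1 * p.2)%g);
  invg_continuous : continuous (fun x : G => (x^-1)%g);
  lcg_hausdorff : hausdorff_space G;
  lcg_locally_compact : locally_compact [set: G] }.

#[short(type="lcGroupType")]
HB.structure Definition LCGroup :=
  {G of PointedTopological G & Group G & isLCGroup G}.

Section complex_facts.
Context {R : realType}.
Implicit Types z : R[i].

Lemma complex_nat_bound z : exists n : nat, `|z| < n%:R.
Proof.
rewrite normc_def; set r := Num.sqrt _; exists (Num.bound r).
rewrite -(rmorph_nat (real_complex R)) ltcR.
by apply: archi_boundP; exact: sqrtr_ge0.
Qed.

Lemma phaseP z : exists2 c, `|c| <= 1 & c * z = `|z|.
Proof.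
have [->|z0] := eqVneq z 0; first by exists 0; rewrite ?normr0 ?mul0r.
exists (`|z| / z); last by rewrite divfK.
by rewrite normrM normr_id normfV divff// normr_eq0.
Qed.

End complex_facts.

Section level_sets.
Context {R : realType} {G : topologicalType}.

Lemma level_Nge (u : G -> R[i]) (e : R[i]) x :
  0 < e -> ~ e <= `|u x| -> `|u x| < e.
Proof.
by move=> e0 /negP; rewrite -real_ltNge ?normr_real// gtr0_real.
Qed.

Lemma closed_level (u : G -> R[i]) (e : R[i]) :
  0 < e -> continuous u -> closed [set x | e <= `|u x|].
Proof.
move=> e0 cu; rewrite -[X in closed X]setCK closedC.
rewrite (_ : ~` _ = [set x | `|u x| < e]); last first.
  apply/seteqP; split=> x /=; first exact: level_Nge.
  by move=> uxe eux; have := lt_le_trans uxe eux; rewrite ltxx.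
rewrite openE => x /= uxe.
exact: (cvgr_norm_lt _ (cu x) _ uxe).
Qed.

End level_sets.

Section C0.
Context (R : realType) (G : topologicalType).

Definition C0_pred : {pred G -> R[i]} := fun u =>
  `[< continuous u /\
      forall e : R[i], 0 < e -> compact [set x | e <= `|u x|] >].

Lemma C0_submod_closed : submod_closed C0_pred.
Proof.
split.
  apply/asboolP; split; first exact: cst_continuous.
  move=> e e0; rewrite (_ : mkset _ = set0); first exact: compact0.
  apply/seteqP; split=> // x /=.
  by rewrite [X in `|X|](_ : _ = 0)// normr0 => /(lt_le_trans e0); rewrite ltxx.
move=> a u v /asboolP[cu ku] /asboolP[cv kv]; apply/asboolP.
have cw : continuous (a *: u + v).
  by move=> x; apply: cvgD; [apply: cvgZr; exact: cu|exact: cv].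
split => // e e0.
have a1 : 0 < `|a| + 1 by rewrite ltr_wpDl.
have e1 : 0 < e / 2 / (`|a| + 1) by rewrite !divr_gt0.
have e2 : 0 < e / 2 by rewrite divr_gt0.
apply: (subclosed_compact _ (compactU (ku _ e1) (kv _ e2))).
  exact: closed_level.
move=> x /= ex; apply: contrapT => /not_orP[/= /level_Nge ux /level_Nge vx].
have {}ux := ux e1; have {}vx := vx e2.
suff h : `|a * u x + v x| < e by have := le_lt_trans ex h; rewrite ltxx.
apply: le_lt_trans (ler_normD _ _) _.
rewrite [ltRHS]splitr ler_ltD// normrM.
apply: (@le_trans _ _ ((`|a| + 1) * (e / 2 / (`|a| + 1)))).
  by apply: ler_pM => //; [rewrite lerDl|exact: ltW].
by rewrite mulrC divfK ?gt_eqF.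
Qed.

HB.instance Definition _ :=
  GRing.isSubmodClosed.Build R[i] (G -> R[i]) C0_pred C0_submod_closed.

Record C0 := MkC0 { C0_fun :> G -> R[i]; _ : C0_fun \in C0_pred }.

HB.instance Definition _ := [isSub for C0_fun].
HB.instance Definition _ := [Choice of C0 by <:].
HB.instance Definition _ := [SubChoice_isSubLmodule of C0 by <:].

Lemma C0_continuous (u : C0) : continuous u.
Proof. by case: u => u /= /asboolP[]. Qed.

Lemma C0_compact (u : C0) (e : R[i]) : 0 < e -> compact [set x | e <= `|u x|].
Proof. by move=> e0; case: u => u /= /asboolP[_]; exact. Qed.

Lemma C0_bounded (u : C0) : exists2 b : R[i], 0 < b & forall x, `|u x| <= b.
Proof.
have /compact_near_coveringP K := @C0_compact u 1 ltr01.
have [x _|n _ Kn] := K nat \oo (fun n x => `|u x| < n%:R) _.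
  have [n un] := complex_nat_bound (u x).
  exists ([set y | `|u y| < n%:R], [set m | (n <= m)%N]).
    split; last by exists n.
    exact: (cvgr_norm_lt _ (@C0_continuous u x) _ un).
  by move=> [y m] /= [uy nm]; rewrite (lt_le_trans uy)// ler_nat.
exists n.+1%:R; first by rewrite ltr0n.
move=> x; have [/Kn|/level_Nge] := pselect (1 <= `|u x|).
  by move=> /(_ n (leqnn n)) /ltW /le_trans -> //; rewrite ler_nat.
by move=> /(_ ltr01) /ltW /le_trans -> //; rewrite ler1n.
Qed.

End C0.

(* The measure algebra M(G): a finite regular complex Borel measure on G is
   identified with the bounded linear functional on C_0(G) it defines, [mu u]
   being the integral of [u] against [mu].  The bound [B * b] is quantified over
   all upper bounds [b] of [u] instead of mentioning the sup norm of [u]. *)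
Section measure_algebra.
Context (R : realType) (G : topologicalType).

Record cmeas := MkCmeas {
  cmeas_fun :> C0 R G -> R[i];
  cmeas_scalar : scalar cmeas_fun;
  cmeas_bounded : exists B : R[i], forall (u : C0 R G) (b : R[i]),
    (forall x, `|u x| <= b) -> `|cmeas_fun u| <= B * b }.

HB.instance Definition _ (mu : cmeas) :=
  GRing.isLinear.Build R[i] (C0 R G) R[i] *%R (cmeas_fun mu) (cmeas_scalar mu).

HB.instance Definition _ := gen_eqMixin cmeas.
HB.instance Definition _ := gen_choiceMixin cmeas.

(* the weak* topology *)
HB.instance Definition _ := Topological.copy cmeas
  (initial_topology
    (fun mu : cmeas => (mu : C0 R G -> R[i]) : {ptws C0 R G -> R[i]})).

End measure_algebra.

Lemma initial_cvgP (S : choiceType) (T : topologicalType) (f : S -> T)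
    (F : set_system S) (FF : Filter F) (s : S) :
  F --> (s : initial_topology f) <-> f @ F --> f s.
Proof.
split=> [Fs|Fs A].
  by move=> A /(@initial_continuous _ _ f s) /Fs.
rewrite nbhsE => -[B [[C oC CB] Bs] BA].
apply: filterS BA _; rewrite -CB; apply: Fs; apply: open_nbhs_nbhs; split=> //.
by move: Bs; rewrite -CB.
Qed.

(* weak* convergence is convergence of the integrals of each [u] in C_0(G) *)
Lemma cmeas_cvgP (R : realType) (G : topologicalType)
    (F : set_system (cmeas R G)) (FF : Filter F) (mu : cmeas R G) :
  F --> mu <-> forall u : C0 R G, nu u @[nu --> F] --> mu u.
Proof.
rewrite (initial_cvgP
  (fun mu : cmeas R G => (mu : C0 R G -> R[i]) : {ptws C0 R G -> R[i]})).
rewrite cvg_sup; split=> h u; have := h u.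
  by move/(initial_cvgP (fun f : C0 R G -> R[i] => f u)).
by move=> hu; apply/(initial_cvgP (fun f : C0 R G -> R[i] => f u)).
Qed.

Section convolution.
Context {R : realType} {G : lcGroupType}.
Implicit Types (u : C0 R G) (mu nu : cmeas R G).

Lemma mulg_compact (A B : set G) : compact A -> compact B ->
  compact [set (p.1 * p.2)%g | p in A `*` B].
Proof.
move=> cA cB; apply: (continuous_compact _ (compact_setX cA cB)).
by apply: continuous_subspaceT; exact: mulg_continuous.
Qed.

Lemma invg_compact (A : set G) : compact A -> compact [set (x^-1)%g | x in A].
Proof.
move=> cA; apply: continuous_compact => //.
by apply: continuous_subspaceT; exact: invg_continuous.
Qed.

Lemma cvgMg (T : Type) (F : set_system T) (FF : Filter F) (f g : T -> G) a b :
  f @ F --> a -> g @ F --> b -> (f x * g x)%g @[x --> F] --> (a * b)%g.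
Proof.
move=> fa gb.
apply: (@continuous2_cvg _ _ _ _ _ _ _ _ (fun x y => (x * y)%g) _ _ _ fa gb).
exact: (mulg_continuous (a, b)).
Qed.

Lemma mulgl_continuous (x : G) : continuous (fun y : G => (x * y)%g).
Proof. by move=> y; apply: cvgMg; [exact: cvg_cst|exact: cvg_id]. Qed.

Lemma mulgr_continuous (x : G) : continuous (fun y : G => (y * x)%g).
Proof. by move=> y; apply: cvgMg; [exact: cvg_id|exact: cvg_cst]. Qed.

Lemma translate_subproof (x : G) u :
  (fun y => u (x * y)%g) \in @C0_pred R G.
Proof.
have cxu : continuous (fun y => u (x * y)%g).
  move=> y; apply: (@cvg_comp _ _ _ (fun y => (x * y)%g) u).
    exact: mulgl_continuous.
  exact: C0_continuous.
apply/asboolP; split => // e e0.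
apply: (subclosed_compact _ (mulg_compact (@compact_set1 _ (x^-1)%g)
  (C0_compact (u := u) e0))); first exact: closed_level.
by move=> y /= ey; exists ((x^-1)%g, (x * y)%g); rewrite //= mulKg.
Qed.

Definition translate (x : G) u : C0 R G := MkC0 (translate_subproof x u).

Lemma C0_uniform u (e : R[i]) : 0 < e ->
  \forall v \near (1%g : G), forall z, `|u z - u (v * z)%g| < e.
Proof.
move=> e0; pose P (v z : G) := `|u z - u (v * z)%g| < e.
pose K := [set z | e / 2 <= `|u z|].
have cK : compact K by apply: C0_compact; rewrite divr_gt0.
have nP : \forall v \near (1%g : G), K `<=` P v.
  have /compact_near_coveringP := cK; apply => z Kz.
  have c : continuous (fun p : G * G => u p.1 - u (p.2 * p.1)%g).
    move=> p; apply: cvgB.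
      apply: (@cvg_comp _ _ _ fst u); [exact: cvg_fst|exact: C0_continuous].
    apply: (@cvg_comp _ _ _ (fun p => (p.2 * p.1)%g) u);
      last exact: C0_continuous.
    by apply: cvgMg; [exact: cvg_snd|exact: cvg_fst].
  have := cvgr_norm_lt _ (c (z, 1%g)) e; rewrite /= mul1g subrr normr0.
  by move=> /(_ _ e0).
have nQ : \forall v \near (1%g : G), K `<=` P (v^-1)%g.
  have := @invg_continuous G (1%g : G); rewrite /continuous_at invg1.
  by move=> /(_ _ nP).
near=> v => z.
have Pv : K `<=` P v by near: v.
have Pw : K `<=` P (v^-1)%g by near: v.
have [/Pv//|/level_Nge uz] := pselect (K z).
have [/Pw|/level_Nge uvz] := pselect (K (v * z)%g).
  by rewrite /P mulKg distrC.
rewrite (le_lt_trans (ler_normB _ _))// [ltRHS]splitr.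
by apply: ltrD; [apply: uz|apply: uvz]; rewrite divr_gt0.
Unshelve. all: by end_near. Qed.

Lemma cmeas_pos_bound mu : exists2 B : R[i], 0 < B &
  forall u b, (forall x, `|u x| <= b) -> `|mu u| <= B * b.
Proof.
have [B muB] := cmeas_bounded mu; exists (`|B| + 1); first by rewrite ltr_wpDl.
move=> u b ub; have b0 : 0 <= b by apply: le_trans (ub 1%g).
have B0 : 0 <= B * b by apply: le_trans (muB u b ub).
rewrite (le_trans (muB u b ub))// -(ger0_norm B0) normrM (ger0_norm b0).
by rewrite ler_wpM2r// lerDl.
Qed.

Lemma convol_fun_continuous nu u : continuous (fun x => nu (translate x u)).
Proof.
move=> x; have [B B0 nuB] := cmeas_pos_bound nu.
apply/pseudometric_normed_Zmodule.cvgrPdist_lt => e e0.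
have d0 : 0 < e / 2 / B by rewrite !divr_gt0.
have vx : (y * x^-1)%g @[y --> x] --> (1%g : G).
  by have := @mulgr_continuous (x^-1)%g x; rewrite /continuous_at mulgV.
have := vx _ (C0_uniform u d0); apply: (@filterS _ (nbhs x) _) => y /= uy.
rewrite -raddfB (@le_lt_trans _ _ (B * (e / 2 / B)))//.
  apply: nuB => z; apply: ltW; have := uy (x * z)%g.
  by rewrite -!mulgA mulKg.
by rewrite mulrC divfK ?gt_eqF// ltr_pdivrMr// ltr_pMr// ltr1n.
Qed.

Lemma convol_fun_pack nu u (e b B d : R[i]) : 0 < e -> 0 < d -> 0 < b ->
  (forall x, `|u x| <= b) ->
  ~ compact [set x | e <= `|nu (translate x u)|] ->
  forall N : nat, exists f : C0 R G, exists T : set G,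
  [/\ compact T, forall y, `|f y| <= b + N%:R * d,
    forall y, ~ T y -> `|f y| <= N%:R * d & N%:R * e <= nu f].
Proof.
move=> e0 d0 b0 ub nK; elim=> [|N [f [T [cT fb fT nuf]]]].
  exists 0, set0; split; first exact: compact0.
  - by move=> y; rewrite mul0r addr0 normr0 ltW.
  - by move=> y _; rewrite mul0r normr0.
  - by rewrite mul0r raddf0.
pose S := [set x | d <= `|u x|].
have cS : compact S by exact: C0_compact.
pose W := [set (p.1 * p.2)%g | p in S `*` [set (x^-1)%g | x in T]].
have cW : compact W by apply: mulg_compact => //; exact: invg_compact.
have [x [xe xW]] : exists x, e <= `|nu (translate x u)| /\ ~ W x.
  apply: contrapT => h; apply: nK; apply: (subclosed_compact _ cW).
    by apply: closed_level => //; exact: convol_fun_continuous.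
  by move=> x xe; apply: contrapT => xW; apply: h; exists x.
have [c c1 cE] := phaseP (nu (translate x u)).
have cu y : `|c * u (x * y)%g| <= `|u (x * y)%g|.
  by rewrite normrM ler_piMl.
exists (c *: translate x u + f), (T `|` [set y | S (x * y)%g]); split.
- apply: compactU => //.
  exact: (@C0_compact _ _ (translate x u)).
- move=> y; rewrite (le_trans (ler_normD _ _))//= -natr1 mulrDl mul1r.
  have [Ty|Ty] := pselect (T y).
    rewrite addrA [leLHS]addrC lerD ?fb// (le_trans (cu y))//.
    apply: ltW; apply: level_Nge => // Sxy; apply: xW.
    exists ((x * y)%g, (y^-1)%g); last by rewrite /= mulgK.
    by split => //=; exists y.
  rewrite lerD ?(le_trans (cu y))// (le_trans (fT _ Ty))//.
  by rewrite lerDl ltW.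
- move=> y /= /not_orP[Ty Sy]; rewrite (le_trans (ler_normD _ _))//=.
  rewrite -natr1 mulrDl mul1r [leLHS]addrC lerD ?fT// (le_trans (cu y))//.
  by apply: ltW; apply: level_Nge.
- by rewrite linearP/= cE -natr1 mulrDl mul1r [leLHS]addrC lerD.
Qed.

Lemma convol_fun_subproof nu u :
  (fun x => nu (translate x u)) \in @C0_pred R G.
Proof.
apply/asboolP; split; first exact: convol_fun_continuous.
move=> e e0; apply: contrapT => nK.
have [B B0 nuB] := cmeas_pos_bound nu.
have [b b0 ub] := C0_bounded u.
have d0 : 0 < e / 2 / B by rewrite !divr_gt0.
have [N Nlt] := complex_nat_bound (B * b / (e / 2)).
have [f [T [_ fb _ nuf]]] := convol_fun_pack B e0 d0 b0 ub nK N.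
have p0 : 0 < B * b / (e / 2) by rewrite !(mulr_gt0, invr_gt0, divr_gt0).
move: Nlt; rewrite gtr0_norm// ltr_pdivrMr ?divr_gt0// => Nlt.
have nuf0 : 0 <= nu f by rewrite (le_trans _ nuf)// mulr_ge0// ltW.
have := le_trans nuf (le_trans (real_ler_norm (ger0_real nuf0)) (nuB _ _ fb)).
rewrite mulrDr mulrCA [B * (_ / B)]mulrC divfK ?gt_eqF//.
rewrite {1}[e]splitr mulrDr lerD2r => /(lt_le_trans Nlt).
by rewrite ltxx.
Qed.

(* the function whose value at [x] is the [nu]-integral of [y |-> u (x * y)] *)
Definition convol_fun nu u : C0 R G := MkC0 (convol_fun_subproof nu u).

Lemma convol_scalar mu nu : scalar (fun u => mu (convol_fun nu u)).
Proof.
move=> a u v /=; rewrite -(linearP mu); congr (mu _).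
apply/val_inj/funext => x /=.
have -> : translate x (a *: u + v) = a *: translate x u + translate x v.
  exact/val_inj.
exact: linearP.
Qed.

Lemma convol_bounded mu nu : exists B : R[i], forall u b,
  (forall x, `|u x| <= b) -> `|mu (convol_fun nu u)| <= B * b.
Proof.
have [B _ muB] := cmeas_pos_bound mu; have [B' _ nuB] := cmeas_pos_bound nu.
exists (B * B') => u b ub; rewrite -mulrA; apply: muB => x.
by apply: nuB => y; exact: ub.
Qed.

(* [convol mu nu u] is the iterated integral of [u (x * y)] with respect to
   [nu] in [y], then [mu] in [x]. *)
Definition convol mu nu : cmeas R G :=
  MkCmeas (convol_scalar mu nu) (convol_bounded mu nu).

Lemma zerom_scalar : scalar (fun _ : C0 R G => 0 : R[i]).
Proof. by move=> a u v; rewrite mulr0 addr0. Qed.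

Lemma zerom_bounded : exists B : R[i], forall u b,
  (forall x, `|u x| <= b) -> `|(0 : R[i])| <= B * b.
Proof. by exists 0 => u b _; rewrite normr0 mul0r. Qed.

Definition zerom : cmeas R G := MkCmeas zerom_scalar zerom_bounded.

Lemma diracm_scalar (x : G) : scalar (fun u : C0 R G => u x).
Proof. by []. Qed.

Lemma diracm_bounded (x : G) : exists B : R[i], forall u b,
  (forall x, `|u x| <= b) -> `|u x| <= B * b.
Proof. by exists 1 => u b ub; rewrite mul1r. Qed.

Definition diracm (x : G) : cmeas R G :=
  MkCmeas (@diracm_scalar x) (diracm_bounded x).

(* [convol_pow mu 0] is the unit of M(G), the point mass at the identity. *)
Definition convol_pow mu (n : nat) : cmeas R G :=
  iterop n convol mu (diracm 1%g).

End convolution.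

Section compact_subgroups.
Context {G : lcGroupType}.

Definition subgroup (H : set G) := [/\ H 1%g,
  forall x y, H x -> H y -> H (x * y)%g & forall x, H x -> H (x^-1)%g].

Definition closed_subgroup_gen (S : set G) : set G :=
  smallest [set H | subgroup H /\ closed H] S.

Definition prod_set (m : nat) (K : 'I_m -> set G) : set G :=
  [set (\prod_(j < m) k j)%g | k in [set k : 'I_m -> G | forall j, K j (k j)]].

End compact_subgroups.

Notation borel G := (g_sigma_algebraType (@open G)).

Record csubgroup (G : lcGroupType) := MkCsubgroup {
  csubgroup_set :> set G;
  csubgroup_subgroup : subgroup csubgroup_set;
  csubgroup_compact : compact csubgroup_set }.

(* Functions are total on [G]; only their values on [K] are relevant. *)
Record mchar (R : realType) (G : lcGroupType) (K : csubgroup G) := MkMchar {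
  mchar_fun :> G -> R[i];
  mchar_continuous : {within (K : set G), continuous mchar_fun};
  mchar_morph : forall x y, (K : set G) x -> (K : set G) y ->
    mchar_fun (x * y)%g = mchar_fun x * mchar_fun y;
  mchar_norm : forall x, (K : set G) x -> `|mchar_fun x| = 1 }.

(* A normalised Haar measure on [K], seen as a Borel measure on [G] carried
   by [K]. *)
Record haar (R : realType) (G : lcGroupType) (K : csubgroup G) := MkHaar {
  haar_prob :> probability (borel G) R;
  haar_carrier : haar_prob (K : set G) = 1%E;
  haar_invariant : forall (x : G) (A : set (borel G)),
    (K : set G) x -> measurable A ->
    haar_prob [set (x * y)%g | y in A] = haar_prob A;
  haar_regular : forall A : set (borel G), measurable A ->
    haar_prob A = ereal_sup
      [set haar_prob C | C in [set C : set G | compact C /\ C `<=` A]] }.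

Section complex_integral.
Context {R : realType} {G : lcGroupType}.
Implicit Types (m : probability (borel G) R) (f g : G -> R[i]) (K : set G).

Definition cintegral m K f : R[i] :=
  (\int[m]_(x in K) complex.Re (f x)) +i* (\int[m]_(x in K) complex.Im (f x)).

Lemma normc_ge_Im (z : R[i]) : `|complex.Im z|%:C <= `|z|.
Proof.
rewrite normc_def lecR -[leLHS]ger0_norm// -sqrtr_sqr ler_sqrt.
  by rewrite real_normK ?num_real// lerDr sqr_ge0.
by rewrite addr_ge0 ?sqr_ge0.
Qed.

Lemma Re_continuous : continuous (@complex.Re R : R[i] -> R).
Proof.
move=> z.
apply/(@pseudometric_normed_Zmodule.cvgrPdist_lt _ _ _ (nbhs z)) => e e0.
have e0C : 0 < e%:C by rewrite ltcR.
near=> w; rewrite -ltcR; apply: le_lt_trans (_ : `|z - w| < e%:C).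
  by apply: le_trans (normc_ge_Re _); rewrite raddfB.
near: w; exact: (@nbhsx_ballx _ R[i] z e%:C e0C).
Unshelve. all: by end_near. Qed.

Lemma Im_continuous : continuous (@complex.Im R : R[i] -> R).
Proof.
move=> z.
apply/(@pseudometric_normed_Zmodule.cvgrPdist_lt _ _ _ (nbhs z)) => e e0.
have e0C : 0 < e%:C by rewrite ltcR.
near=> w; rewrite -ltcR; apply: le_lt_trans (_ : `|z - w| < e%:C).
  by apply: le_trans (normc_ge_Im _); rewrite raddfB.
near: w; exact: (@nbhsx_ballx _ R[i] z e%:C e0C).
Unshelve. all: by end_near. Qed.

Lemma compact_borel K : compact K -> measurable (K : set (borel G)).
Proof.
move=> /(compact_closed (@lcg_hausdorff G)) /closed_openC oK.
rewrite -[X in measurable X]setCK; apply: measurableC.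
exact: sub_sigma_algebra.
Qed.

Lemma borel_measurable_fun K (h : G -> R) : compact K ->
  {within K, continuous h} -> measurable_fun (K : set (borel G)) h.
Proof.
move=> cK /continuousP ch.
apply: (measurability _ (measurable_realfun.RGenOpens.measurableE R)).
move=> _ [_ [a [b ->] <-]].
have /ch /open_subspaceP[V oV VK] : open `]a, b[%classic.
  exact: interval_open.
rewrite setIC -VK; apply: measurableI; last exact: compact_borel.
exact: sub_sigma_algebra.
Qed.

Lemma continuous_integrable m K (h : G -> R) (M : R) : compact K ->
  {within K, continuous h} -> (forall x, K x -> `|h x| <= M) ->
  m.-integrable K (EFin \o h).
Proof.
move=> cK ch hM; apply: measurable_bounded_integrable.
- exact: compact_borel.
- apply: (@le_lt_trans _ _ 1%E); last exact: ltry.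
  by apply: probability_le1; exact: compact_borel.
- exact: borel_measurable_fun.
- exists M; split; first exact: num_real.
  by move=> N /ltW MN x /= Kx; rewrite (le_trans _ MN)// hM.
Qed.

Lemma Rintegral_le m K (h : G -> R) (M : R) : compact K ->
  {within K, continuous h} -> (forall x, K x -> `|h x| <= M) -> 0 <= M ->
  `|\int[m]_(x in K) h x| <= M.
Proof.
move=> cK ch hM M0; have mK := compact_borel cK.
have ih := continuous_integrable m cK ch hM.
apply: (le_trans (le_normr_Rintegral mK ih)).
apply: (@le_trans _ _ (\int[m]_(x in K) M)).
  apply: le_Rintegral => //.
  - exact: integrable_abse ih.
  - apply: (@continuous_integrable _ _ _ M) => //.
      by apply: continuous_subspaceT; exact: cst_continuous.
    by move=> x _; rewrite ger0_norm.
rewrite Rintegral_cst// ler_piMr// -lee_fin fineK ?probability_le1//.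
exact: fin_num_measure.
Qed.

Lemma Re_le (z b : R[i]) : `|z| <= b -> `|complex.Re z| <= complex.Re b.
Proof.
move=> zb; have := le_trans (normc_ge_Re z) zb.
by rewrite lecE => /andP[].
Qed.

Lemma Im_le (z b : R[i]) : `|z| <= b -> `|complex.Im z| <= complex.Re b.
Proof.
move=> zb; have := le_trans (normc_ge_Im z) zb.
by rewrite lecE => /andP[].
Qed.

Lemma Re_within K f : {within K, continuous f} ->
  {within K, continuous (@complex.Re R \o f)}.
Proof.
move=> cf x; apply: (@continuous_comp (subspace K) R[i] R f); first exact: cf.
exact: Re_continuous.
Qed.

Lemma Im_within K f : {within K, continuous f} ->
  {within K, continuous (@complex.Im R \o f)}.
Proof.
move=> cf x; apply: (@continuous_comp (subspace K) R[i] R f); first exact: cf.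
exact: Im_continuous.
Qed.

Lemma cintegral_lin m K f g (a b c : R[i]) : compact K ->
  {within K, continuous f} -> {within K, continuous g} ->
  (forall x, K x -> `|f x| <= b) -> (forall x, K x -> `|g x| <= c) ->
  cintegral m K (fun x => a * f x + g x) =
  a * cintegral m K f + cintegral m K g.
Proof.
move=> cK cf cg fb gb; have mK := compact_borel cK.
have irf : m.-integrable K (EFin \o (@complex.Re R \o f)).
  apply: (continuous_integrable m cK (Re_within cf)) => x Kx.
  exact: Re_le (fb x Kx).
have jrf : m.-integrable K (EFin \o (@complex.Im R \o f)).
  apply: (continuous_integrable m cK (Im_within cf)) => x Kx.
  exact: Im_le (fb x Kx).
have irg : m.-integrable K (EFin \o (@complex.Re R \o g)).
  apply: (continuous_integrable m cK (Re_within cg)) => x Kx.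
  exact: Re_le (gb x Kx).
have jrg : m.-integrable K (EFin \o (@complex.Im R \o g)).
  apply: (continuous_integrable m cK (Im_within cg)) => x Kx.
  exact: Im_le (gb x Kx).
have lin (s t : R) (p q r : G -> R) :
    m.-integrable K (EFin \o p) -> m.-integrable K (EFin \o q) ->
    m.-integrable K (EFin \o r) ->
    \int[m]_(x in K) (s * p x + t * q x + r x) =
    s * (\int[m]_(x in K) p x) + t * (\int[m]_(x in K) q x) +
    \int[m]_(x in K) r x.
  move=> ip iq ir.
  have isp : m.-integrable K (EFin \o (fun x => s * p x)).
    exact: (integrableZl mK s ip).
  have itq : m.-integrable K (EFin \o (fun x => t * q x)).
    exact: (integrableZl mK t iq).
  rewrite RintegralD//; last exact: (integrableD mK isp itq).
  by rewrite RintegralD// !RintegralZl.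
rewrite /cintegral; case: a => s t; apply/eqP; rewrite eq_complex /=.
apply/andP; split; apply/eqP.
  rewrite -mulNr -lin//; apply: eq_Rintegral => x _.
  by case: (f x) => p q; case: (g x) => ? ? /=; rewrite mulNr.
rewrite -lin//; apply: eq_Rintegral => x _.
by case: (f x) => p q; case: (g x) => ? ? /=.
Qed.

Lemma cintegral_bound m K f (b : R[i]) : compact K -> K !=set0 ->
  {within K, continuous f} -> (forall x, K x -> `|f x| <= b) ->
  `|cintegral m K f| <= 2 * b.
Proof.
move=> cK [k Kk] cf fb.
have b0 : 0 <= b by apply: le_trans (fb k Kk).
have Rb0 : 0 <= complex.Re b by move: b0; rewrite lecE => /andP[].
have rle := Rintegral_le m cK (Re_within cf) (fun x Kx => Re_le (fb x Kx)) Rb0.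
have ile := Rintegral_le m cK (Im_within cf) (fun x Kx => Im_le (fb x Kx)) Rb0.
rewrite /cintegral [X in `|X|]complexE /=; apply: le_trans (ler_normD _ _) _.
rewrite normrM.
have -> : `|'i%C : R[i]| = 1.
  by rewrite normc_def/= expr0n/= expr1n add0r sqrtr1.
rewrite mul1r -(RRe_real (ger0_real b0)) mulr_natl mulr2n !normc_def/=.
by rewrite !expr0n/= !addr0 !sqrtr_sqr lerD ?lecR.
Qed.

End complex_integral.

Section character_measures.
Context {R : realType} {G : lcGroupType} (K : csubgroup G).
Variables (mK : haar R K) (rho : mchar R K).

Definition char_meas_fun (u : C0 R G) : R[i] :=
  cintegral mK K (fun k => u k * rho k).

Lemma char_meas_within (u : C0 R G) :
  {within (K : set G), continuous (fun k => u k * rho k)}.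
Proof.
move=> x; apply: cvgM; last exact: mchar_continuous.
by apply: continuous_subspaceT; exact: C0_continuous.
Qed.

Lemma char_meas_le (u : C0 R G) b x : (K : set G) x ->
  `|u x| <= b -> `|u x * rho x| <= b.
Proof. by move=> Kx ub; rewrite normrM (mchar_norm rho Kx) mulr1. Qed.

Lemma char_meas_scalar : scalar char_meas_fun.
Proof.
move=> a u v; rewrite /char_meas_fun.
have [b _ ub] := C0_bounded u; have [c _ vc] := C0_bounded v.
rewrite -(@cintegral_lin _ _ _ _ _ _ a b c).
- congr (cintegral _ _ _); apply/funext => k /=.
  by rewrite [in LHS]mulrDl -mulrA.
- exact: csubgroup_compact.
- exact: char_meas_within.
- exact: char_meas_within.
- by move=> x Kx; exact: char_meas_le.
- by move=> x Kx; exact: char_meas_le.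
Qed.

Lemma char_meas_bounded : exists B : R[i], forall (u : C0 R G) b,
  (forall x, `|u x| <= b) -> `|char_meas_fun u| <= B * b.
Proof.
exists 2 => u b ub; apply: cintegral_bound.
- exact: csubgroup_compact.
- by exists 1%g; case: (csubgroup_subgroup K).
- exact: char_meas_within.
- by move=> x Kx; exact: char_meas_le.
Qed.

(* the measure [rho m_K] on G *)
Definition char_meas : cmeas R G := MkCmeas char_meas_scalar char_meas_bounded.

End character_measures.

(* Main.v *)
Require Import Defs.
From HB Require Import structures.
From mathcomp Require Import all_boot all_order all_algebra.
From mathcomp Require Import all_classical all_reals all_analysis.
From mathcomp Require Import complex.
From mathcomp Require finmap.
From mathcomp Require Import measurable_realfun ring lra.

(* Convolution with [mu] acts on C_0(G) as a composition [T] of operators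
   [P_j u x = \int_(K_j) u (x k) rho_j k dk], and the n-th power of [mu] is
   [u |-> (T^n u) 1].  On [L], each [P_j] is an idempotent contraction both for
   the sup norm and for the L^2 norm.  The iterates [T^n u] are equicontinuous,
   so a subnet converges uniformly on [L] to some [g]; since the L^2 norms of
   the iterates decrease, [T g] and [g] have the same L^2 norm, and strict
   convexity forces [P_j g = g] on [L] for all [j].  The contraction property
   then turns subconvergence into convergence.  Finally [P_j g = g] says that
   [g (x k) * rho_j k = g x] for [k] in [K_j]: if [g 1 != 0], then
   [h |-> g (h^-1) / g 1] is a character of [L] extending all the [rho_j];
   and if such a character [chi] exists, then [g] is the L^2 projection of [u]
   on the line spanned by the conjugate of [chi], whose value at 1 is the
   integral of [u] against [chi m_L]. *)

Set Implicit Arguments.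
Unset Strict Implicit.
Unset Printing Implicit Defensive.

Import Order.TTheory GRing.Theory Num.Theory numFieldNormedType.Exports.

Local Open Scope classical_set_scope.
Local Open Scope ring_scope.

(** * Integrals of continuous functions on compact sets *)

Section real_integrals.
Context {R : realType} {G : lcGroupType}.
Implicit Types (m : probability (borel G) R) (h : G -> R) (K : set G).

Lemma within_bounded K h : compact K -> {within K, continuous h} ->
  exists2 M, 0 < M & forall x, K x -> `|h x| <= M.
Proof.
move=> cK ch; have /compact_bounded := continuous_compact ch cK.
by move=> /pinfty_ex_gt0[M M0 hM]; exists M => // x Kx; apply: hM; exists x.
Qed.

Lemma within_integrable m K h : compact K -> {within K, continuous h} ->
  m.-integrable K (EFin \o h).
Proof.
by move=> cK ch; have [M _ hM] := within_bounded cK ch;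
  exact: (continuous_integrable m cK ch hM).
Qed.

Lemma Rintegral_prob_cst m K (c : R) : compact K -> m K = 1%E ->
  \int[m]_(x in K) c = c.
Proof.
move=> /compact_borel bK mK1; rewrite Rintegral_cst//.
by rewrite [X in fine X](_ : _ = 1%E) ?mulr1.
Qed.

Lemma ler_Rintegral m K h1 h2 : compact K ->
  {within K, continuous h1} -> {within K, continuous h2} ->
  (forall x, K x -> h1 x <= h2 x) ->
  \int[m]_(x in K) h1 x <= \int[m]_(x in K) h2 x.
Proof.
move=> cK c1 c2 h12; apply: le_Rintegral => //; first exact: compact_borel.
- exact: within_integrable.
- exact: within_integrable.
Qed.

Lemma within_comb K h1 h2 (a : R) : {within K, continuous h1} ->
  {within K, continuous h2} ->
  {within K, continuous (fun x => h1 x + a * h2 x)}.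
Proof.
move=> c1 c2 x; apply: (@cvgD _ R^o); first exact: c1.
by apply: cvgM; [exact: cvg_cst|exact: c2].
Qed.

Lemma Rintegral_comb m K h1 h2 (a : R) : compact K ->
  {within K, continuous h1} -> {within K, continuous h2} ->
  \int[m]_(x in K) (h1 x + a * h2 x) =
  \int[m]_(x in K) h1 x + a * \int[m]_(x in K) h2 x.
Proof.
move=> cK c1 c2; have mK := compact_borel cK.
rewrite RintegralD ?RintegralZl//; try exact: within_integrable.
apply: (@within_integrable m K (fun x => a * h2 x)) => // x.
by apply: cvgM; [exact: cvg_cst|exact: c2].
Qed.

(** The variance is nonnegative: with [A] the mean of [h], expand the integral of [(h - A)^2]. *)
Lemma Rintegral_sqr m K h : compact K -> m K = 1%E ->
  {within K, continuous h} ->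
  (\int[m]_(x in K) h x) ^+ 2 <= \int[m]_(x in K) (h x ^+ 2).
Proof.
move=> cK mK1 ch; set A := \int[m]_(x in K) h x.
have c2 : {within K, continuous (fun x => h x ^+ 2)}.
  by move=> x; apply: (@cvgM _ _ (nbhs (x : subspace K))); exact: ch.
have cA (c : R) : {within K, continuous (fun=> c)}.
  by apply: continuous_subspaceT; exact: cst_continuous.
have : 0 <= \int[m]_(x in K) ((h x - A) ^+ 2).
  by apply: Rintegral_ge0 => x _; exact: sqr_ge0.
rewrite [leRHS](_ : _ = \int[m]_(x in K)
  ((h x ^+ 2 + (- 2 * A) * h x) + 1 * A ^+ 2)); last first.
  apply: eq_Rintegral => x _.
  by rewrite sqrrB mul1r mulNr mulNr mulr_natl mulrnAl [A * _]mulrC.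
rewrite Rintegral_comb//; last exact: within_comb.
rewrite Rintegral_comb// Rintegral_prob_cst// -/A.
rewrite -mulrA -expr2 mul1r mulNr mulr_natl mulr2n opprD addrA subrK.
by rewrite subr_ge0.
Qed.

End real_integrals.

Lemma within_mulgl (R : topologicalType) (G : lcGroupType) (K : csubgroup G)
    (h : G -> R) k : (K : set G) k ->
  {within (K : set G), continuous h} ->
  {within (K : set G), continuous (fun x => h (k * x)%g)}.
Proof.
have [K1 KM KV] := csubgroup_subgroup K.
move=> Kk /subspace_continuousP ch; apply/subspace_continuousP => x Kx.
apply: cvg_comp (ch _ (KM _ _ Kk Kx)).
move=> A; rewrite /within /= => nA.
have := @mulgl_continuous _ k x _ nA.
by apply: (@filterS _ (nbhs x)) => y /= Ay Ky; apply/Ay/KM.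
Qed.

Lemma measurable_mulgl (G : lcGroupType) (k : G) :
  measurable_fun [set: borel G] (fun x : borel G => (k * x)%g : borel G).
Proof.
apply: (@measurability _ _ (borel G) (borel G) setT _ (@open G)) => //.
move=> _ [A oA <-].
rewrite setTI; apply: sub_sigma_algebra.
by have /continuousP := @mulgl_continuous G k; exact.
Qed.

(** Invariance of [mK] is given on sets and passes to integrals by a change of variables: the
    pushforward of [mK] under left multiplication by [k] agrees with [mK] on Borel sets. Left
    multiplication by [k] preserves [K], hence is compatible with extension by zero off [K]. *)
Lemma Rintegral_translate (R : realType) (G : lcGroupType) (K : csubgroup G)
    (mK : haar R K) (h : G -> R) k : (K : set G) k ->
  {within (K : set G), continuous h} ->
  \int[mK]_(x in K) h (k * x)%g = \int[mK]_(x in K) h x.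
Proof.
have [K1 KM KV] := csubgroup_subgroup K => Kk ch.
have cK := @csubgroup_compact _ K; have bK := compact_borel cK.
pose phi (x : borel G) : borel G := (k * x)%g.
have mphi : measurable_fun setT phi by exact: measurable_mulgl.
have preK : phi @^-1` (K : set G) = K.
  apply/seteqP; split=> x; rewrite /phi/= => Kx; last exact: KM.
  by rewrite -(mulKg k x); apply: KM => //; exact: KV.
have E : (EFin \o h) \_ (K : set G) \o phi =
    (EFin \o (fun x => h (k * x)%g)) \_ (K : set G).
  apply/funext => x /=; rewrite !patchE /=.
  rewrite (_ : (x \in _) = (phi x \in (K : set G)))// -{1}preK.
  by apply/idP/idP; rewrite !inE.
rewrite /Rintegral; congr fine.
rewrite integral_mkcond [RHS]integral_mkcond.
transitivity (\int[pushforward mK phi]_x ((EFin \o h) \_ (K : set G)) x)%E.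
  rewrite integral_pushforward//=.
  - by rewrite preimage_setT -E.
  - apply: (measurable_restrictT _ bK).1.
    by apply/measurable_EFinP; exact: borel_measurable_fun.
  - rewrite preimage_setT E; apply/integrable_restrict => //.
    rewrite setTI; apply: within_integrable => //.
    exact: within_mulgl.
apply: eq_measure_integral => A mA _.
transitivity (mK [set ((k^-1)%g * y)%g | y in A]); last first.
  exact: (haar_invariant mK (KV _ Kk) mA).
congr (mK _); apply/seteqP; split => [x Ax|_ [y Ay <-]].
  by exists (k * x)%g => //; rewrite mulKg.
by rewrite /phi/= mulVKg.
Qed.

Section averages.
Context {R : realType} {G : lcGroupType}.
Implicit Types (m : probability (borel G) R) (K L A : set G).

(** Joint continuity holds near each point of [L] times [k0]; the near-covering form of compactness
    makes it uniform over [L]. *)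
Lemma near_uniform (h : G -> G -> R) L k0 (e : R) : compact L ->
  continuous (fun p : G * G => h p.1 p.2) -> 0 < e ->
  \forall k \near k0, forall x, L x -> `|h x k0 - h x k| < e.
Proof.
move=> cL ch e0; have /compact_near_coveringP := cL.
apply => x Lx.
have c : continuous (fun p : G * G => h p.1 k0 - h p.1 p.2).
  move=> p; apply: (@cvgB _ R^o).
    apply: (@cvg_comp _ _ _ (fun p : G * G => (p.1, k0))
      (fun p : G * G => h p.1 p.2) _ (nbhs (p.1, k0))); last exact: (ch (_, _)).
    by apply: cvg_pair => /=; [exact: cvg_fst|exact: cvg_cst].
  exact: ch.
have := @cvgr_norm_lt _ R^o _ _ _ _ _ (c (x, k0)) e.
by rewrite /= subrr normr0; exact.
Qed.

Lemma Rintegral_mean m A (f : G -> R) (a e : R) :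
  measurable (A : set (borel G)) -> m.-integrable A (EFin \o f) ->
  (forall x, A x -> `|a - f x| <= e) ->
  `|\int[m]_(x in A) f x - a * fine (m A)| <= e * fine (m A).
Proof.
move=> mA fi fa.
have ci (c : R) : m.-integrable A (EFin \o (fun=> c)).
  by apply: finite_measure_integrable_cst.
rewrite ler_norml; apply/andP; split.
  rewrite lerBrDl -mulNr -mulrDl -Rintegral_cst//.
  apply: le_Rintegral => // x Ax; have := fa x Ax.
  by rewrite ler_norml => /andP[_]; rewrite lerBlDr lerBlDl.
rewrite lerBlDl -mulrDl -Rintegral_cst//.
apply: le_Rintegral => // x Ax; have := fa x Ax.
by rewrite distrC ler_norml => /andP[_]; rewrite lerBlDl.
Qed.

Lemma continuous_sectionr (h : G -> G -> R) x :
  continuous (fun p : G * G => h p.1 p.2) -> continuous (h x).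
Proof.
move=> ch k; apply: (@cvg_comp _ _ _ (fun k => (x, k))
  (fun p : G * G => h p.1 p.2) _ (nbhs (x, k))); last exact: (ch (_, _)).
by apply: cvg_pair => /=; [exact: cvg_cst|exact: cvg_id].
Qed.

Lemma continuous_sectionl (h : G -> G -> R) k :
  continuous (fun p : G * G => h p.1 p.2) -> continuous (h ^~ k).
Proof.
move=> ch x; apply: (@cvg_comp _ _ _ (fun x => (x, k))
  (fun p : G * G => h p.1 p.2) _ (nbhs (x, k))); last exact: (ch (_, _)).
by apply: cvg_pair => /=; [exact: cvg_id|exact: cvg_cst].
Qed.

(* A Fubini theorem for constant inner integrals, avoiding the product
   sigma-algebra, which need not contain the Borel sets of [G * G]. *)
Lemma average_approx m m' L K (h : G -> G -> R) (c e : R) :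
  compact L -> compact K -> m' K = 1%E ->
  continuous (fun p : G * G => h p.1 p.2) ->
  (forall k, K k -> \int[m]_(x in L) h x k = c) -> 0 < e ->
  exists s : G -> R, [/\ continuous s, \int[m]_(x in L) s x = c &
    forall x, L x -> `|\int[m']_(k in K) h x k - s x| <= e].
Proof.
move=> cL cK m'K ch hc e0.
pose B k0 : set G := interior [set k | forall x, L x -> `|h x k0 - h x k| < e].
have oB k0 : open (B k0) by exact: open_interior.
have bB k0 : measurable (B k0 : set (borel G)) by exact: sub_sigma_algebra.
have bK := compact_borel cK.
(* Induction over the centres [r] of a finite subcover, for any measurable part [A] of [K] that it
   covers. A new centre [k0] splits off the points of [A] in [B k0], and [s] gains the term [h x k0]
   weighted by their mass; so the integral of [s] stays [c] times the mass of [A]. *)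
suff : forall (r : seq G) (A : set (borel G)), measurable A -> A `<=` K ->
    (forall k, k \in r -> K k) ->
    (forall k, A k -> exists2 k0, k0 \in r & B k0 k) ->
  exists s : G -> R, [/\ continuous s,
    \int[m]_(x in L) s x = c * fine (m' A) &
    forall x, L x -> `|\int[m']_(k in A) h x k - s x| <= e * fine (m' A)].
  move=> H.
  have := cK; rewrite compact_cover => /(_ _ K B).
  case=> [k Kk|k Kk|D DK KD].
  - exact: oB.
  - by exists k => //; apply: near_uniform.
  have [k kD|k Kk|s [cs sc sh]] := H (finmap.enum_fset D) K bK (@subset_refl _ K).
  - exact/set_mem/DK.
  - by have [k0 /= k0D Bk] := KD _ Kk; exists k0.
  have fK : fine (m' K) = 1 by rewrite [X in fine X](_ : _ = 1%E).
  by exists s; move: sc sh; rewrite fK !mulr1.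
elim=> [|k0 r IH] A bA AK rK Ar.
  have -> : A = set0 by apply/seteqP; split=> // k /Ar[].
  exists (fun=> 0); split; first exact: cst_continuous.
    by rewrite measure0 mulr0 Rintegral_cst ?mul0r//; exact: compact_borel.
  by move=> x _; rewrite Rintegral_set0 measure0 subr0 normr0 mulr0.
have bAB : measurable (A `&` B k0 : set (borel G)) by exact: measurableI.
have bAD : measurable (A `\` B k0 : set (borel G)) by exact: measurableD.
have [||||s [cs sc sh]] := IH (A `\` B k0).
- exact: bAD.
- by move=> k [/AK].
- by move=> k kr; apply: rK; rewrite inE kr orbT.
- move=> k [Ak nB]; have [k1] := Ar _ Ak; rewrite inE => /predU1P[->//|k1r] B1.
  by exists k1.
have hi x (A' : set (borel G)) : measurable A' -> A' `<=` K ->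
    m'.-integrable A' (EFin \o h x).
  move=> bA' A'K; apply: (integrableS bK bA' A'K).
  apply: within_integrable => //; apply: continuous_subspaceT.
  exact: continuous_sectionr.
have Kk0 : K k0 by apply: rK; rewrite inE eqxx.
have mA : fine (m' A) = fine (m' (A `\` B k0)) + fine (m' (A `&` B k0)).
  rewrite -fineD ?fin_num_measure// -measureU ?setDIK//.
    by rewrite setUC setUIDK.
  by apply/seteqP; split=> // x [[_ nB] [_ /nB]].
exists (fun x => s x + fine (m' (A `&` B k0)) * h x k0); split.
- move=> x; apply: (@cvgD _ R^o); first exact: cs.
  by apply: cvgM; [exact: cvg_cst|exact: continuous_sectionl].
- rewrite Rintegral_comb//.
  + by rewrite sc hc// mA mulrDr [X in _ + X]mulrC.
  + exact: continuous_subspaceT.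
  + by apply: continuous_subspaceT; exact: continuous_sectionl.
- move=> x Lx.
  have {1}-> : A = A `\` B k0 `|` A `&` B k0 by rewrite setUC setUIDK.
  rewrite Rintegral_setU//.
  + rewrite opprD addrACA (le_trans (ler_normD _ _))// mA mulrDr lerD ?sh//.
    rewrite [X in _ - X]mulrC; apply: Rintegral_mean => //.
      by apply: hi => // k [/AK].
    by move=> k [_] /interior_subset /(_ _ Lx) /ltW.
  + by rewrite setUC setUIDK; exact: hi.
  + by apply/disj_setPS => k [[_ nB] [_ /nB]].
Qed.

End averages.

(** * Convolution with a character measure *)

Section complex_averages.
Context {R : realType} {G : lcGroupType}.
Implicit Types (m : probability (borel G) R) (f : G -> R[i]) (K : set G).

(** The squared modulus, valued in [R] so that it can be integrated; the norm of [R[i]] takes its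
    values in [R[i]]. *)
Definition nsq (z : R[i]) : R := complex.Re z ^+ 2 + complex.Im z ^+ 2.

Lemma nsq_ge0 z : 0 <= nsq z.
Proof. by rewrite addr_ge0// sqr_ge0. Qed.

Lemma nsq_eq0 z : nsq z = 0 -> z = 0.
Proof.
case: z => a b /eqP; rewrite /nsq paddr_eq0 ?sqr_ge0//= !sqrf_eq0.
by case/andP => /eqP-> /eqP->.
Qed.

Lemma nsqE z : (nsq z)%:C%C = `|z| ^+ 2.
Proof. by rewrite normc_def -rmorphXn/= sqr_sqrtr// nsq_ge0. Qed.

Lemma nsqM z w : nsq (z * w) = nsq z * nsq w.
Proof.
by apply: (@complexI R); rewrite rmorphM/= !nsqE normrM exprMn.
Qed.

Lemma nsq_norm1 z : `|z| = 1 -> nsq z = 1.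
Proof. by move=> z1; apply: (@complexI R); rewrite nsqE z1 expr1n. Qed.

Lemma nsq_continuous (T : topologicalType) (f : T -> R[i]) :
  continuous f -> continuous (fun x => nsq (f x)).
Proof.
move=> cf x; apply: (@cvgD _ R^o); apply: (@cvgM _ _ (nbhs x));
  apply: (@cvg_comp _ _ _ f _ _ (nbhs (f x))); try exact: cf;
  by [exact: Re_continuous | exact: Im_continuous].
Qed.

Lemma eq_cintegral m K f g : {in K, f =1 g} ->
  cintegral m K f = cintegral m K g.
Proof.
by move=> fg; rewrite /cintegral; congr (_ +i* _)%C;
  apply: eq_Rintegral => x Kx; rewrite fg.
Qed.

Lemma cintegral_cst m K (c : R[i]) : compact K -> m K = 1%E ->
  cintegral m K (fun=> c) = c.
Proof.
by move=> cK mK1; rewrite /cintegral !Rintegral_prob_cst//; case: c.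
Qed.

Lemma cintegralZ m K f (a b : R[i]) : compact K ->
  {within K, continuous f} -> (forall x, K x -> `|f x| <= b) ->
  cintegral m K (fun x => a * f x) = a * cintegral m K f.
Proof.
move=> cK cf fb.
have c0 : cintegral m K (fun=> 0) = 0.
  by rewrite /cintegral Rintegral_cst ?mul0r//; exact: compact_borel.
have k0 : {within K, continuous (fun=> 0 : R[i])}.
  by apply: continuous_subspaceT; exact: cst_continuous.
have b0 x : K x -> `|0 : R[i]| <= 0 by rewrite normr0.
transitivity (cintegral m K (fun x => a * f x + 0)).
  by apply: eq_cintegral => x _; rewrite addr0.
by rewrite (cintegral_lin m a cK cf k0 fb b0) c0 addr0.
Qed.

(** A phase [c] makes the integral real and nonnegative, which leaves only a real part to bound. The
    constant 1, in place of the 2 of [cintegral_bound], makes the operators contractions. *)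
Lemma cintegral_le m K f (b : R[i]) : compact K -> K !=set0 ->
  {within K, continuous f} -> (forall x, K x -> `|f x| <= b) ->
  `|cintegral m K f| <= b.
Proof.
move=> cK [k Kk] cf fb.
have b0 : 0 <= b by apply: le_trans (fb k Kk).
have [c c1 cE] := phaseP (cintegral m K f).
have ccf : {within K, continuous (fun x => c * f x)}.
  by move=> x; apply: cvgM; [exact: cvg_cst|exact: cf].
have cfb x : K x -> `|c * f x| <= b.
  by move=> Kx; rewrite normrM (le_trans _ (fb x Kx))// ler_piMl.
have := ger0_real (normr_ge0 (cintegral m K f)).
rewrite -cE -(@cintegralZ _ _ _ _ b)// => /RRe_real <-.
rewrite -(RRe_real (ger0_real b0)) lecR /=.
apply: le_trans (ler_norm _) _; apply: Rintegral_le => //.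
- exact: Re_within.
- by move=> x Kx; exact: Re_le (cfb x Kx).
- by move: b0; rewrite lecE => /andP[].
Qed.

Lemma nsq_cintegral m K f : compact K -> m K = 1%E ->
  {within K, continuous f} ->
  nsq (cintegral m K f) <= \int[m]_(x in K) nsq (f x).
Proof.
move=> cK mK1 cf.
have cR := Re_within cf; have cI := Im_within cf.
have sq (h : G -> R) : {within K, continuous h} ->
    {within K, continuous (fun x => h x ^+ 2)}.
  by move=> ch x; apply: (@cvgM _ _ (nbhs (x : subspace K))); exact: ch.
have -> : \int[m]_(x in K) nsq (f x) = \int[m]_(x in K)
    (complex.Re (f x) ^+ 2 + 1 * complex.Im (f x) ^+ 2).
  by apply: eq_Rintegral => x _; rewrite mul1r.
rewrite Rintegral_comb//; [|exact: (sq _ cR)|exact: (sq _ cI)].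
by rewrite mul1r; apply: lerD; apply: Rintegral_sqr.
Qed.

End complex_averages.

Section convolution_operators.
Context {R : realType} {G : lcGroupType}.
Implicit Types (mu nu : cmeas R G) (u v : C0 R G).

Lemma convol_funP nu (a : R[i]) u v :
  convol_fun nu (a *: u + v) = a *: convol_fun nu u + convol_fun nu v.
Proof.
apply/val_inj/funext => x /=.
rewrite (_ : translate x (a *: u + v) = a *: translate x u + translate x v).
  exact: linearP.
exact/val_inj.
Qed.

(** The integration variable multiplies on the right, so it does not interfere with left
    translations. Equicontinuity of the iterates rests on this. *)
Lemma convol_fun_translate nu x u :
  convol_fun nu (translate x u) = translate x (convol_fun nu u).
Proof.
apply/val_inj/funext => y /=; congr (nu _); apply/val_inj/funext => z /=.
by rewrite mulgA.
Qed.

Lemma convol_fun1 u : convol_fun (diracm 1%g) u = u.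
Proof. by apply/val_inj/funext => x /=; rewrite mulg1. Qed.

Lemma convol_fun_convol mu nu u :
  convol_fun (convol mu nu) u = convol_fun mu (convol_fun nu u).
Proof. by apply/val_inj/funext => x /=; rewrite convol_fun_translate. Qed.

Lemma convol_fun_at1 nu u : convol_fun nu u 1%g = nu u.
Proof. by congr (nu _); apply/val_inj/funext => z /=; rewrite mul1g. Qed.

(** Convolution of measures becomes composition of operators, and evaluation at 1 recovers a measure
    from its operator. *)
Lemma convol_powE mu n u :
  convol_pow mu n u = iter n (convol_fun mu) u 1%g.
Proof.
rewrite -convol_fun_at1; congr (C0_fun _ _); rewrite /convol_pow.
case: n => [|n]; first exact: convol_fun1.
by rewrite iteropS; elim: n => [|n IH] //; rewrite iterS convol_fun_convol IH.
Qed.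

End convolution_operators.

Section character_operator.
Context {R : realType} {G : lcGroupType} (K : csubgroup G).
Variables (mK : haar R K) (rho : mchar R K).
Implicit Types u : C0 R G.

Let P u := convol_fun (char_meas mK rho) u.

Let cK : compact (K : set G). Proof. exact: csubgroup_compact. Qed.

Let within u x :
  {within (K : set G), continuous (fun k => u (x * k)%g * rho k)}.
Proof. exact: (@char_meas_within _ _ K rho (translate x u)). Qed.

Lemma char_op_le u x (b : R[i]) :
  (forall k, (K : set G) k -> `|u (x * k)%g| <= b) -> `|P u x| <= b.
Proof.
move=> ub; apply: cintegral_le => //.
- by exists 1%g; case: (csubgroup_subgroup K).
- exact: within.
- by move=> k Kk; rewrite normrM (mchar_norm rho Kk) mulr1 ub.
Qed.

(** Bring [rho k] under the integral, where it merges with [rho y] into [rho (k * y)], then use Haar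
    invariance to replace [k * y] by [y]. *)
Lemma char_op_equivariant u x k : (K : set G) k ->
  P u (x * k)%g * rho k = P u x.
Proof.
move=> Kk; have [b _ ub] := C0_bounded u.
have fb y : (K : set G) y -> `|u ((x * k) * y)%g * rho y| <= b.
  by move=> Ky; rewrite normrM (mchar_norm rho Ky) mulr1.
transitivity (cintegral mK K (fun y => u (x * (k * y))%g * rho (k * y)%g)).
  rewrite mulrC -(cintegralZ _ _ cK (@within u (x * k)%g) fb).
  by apply: eq_cintegral => y /set_mem Ky; rewrite mchar_morph// mulgA mulrCA.
rewrite /P /= /char_meas_fun /cintegral; congr (_ +i* _)%C.
  by apply: (Rintegral_translate mK (h := fun y =>
    complex.Re (u (x * y)%g * rho y))) => //; exact: (Re_within (@within u x)).
by apply: (Rintegral_translate mK (h := fun y =>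
  complex.Im (u (x * y)%g * rho y))) => //; exact: (Im_within (@within u x)).
Qed.

Lemma char_op_id u x :
  (forall k, (K : set G) k -> u (x * k)%g * rho k = u x) -> P u x = u x.
Proof.
move=> uk; rewrite -[RHS](cintegral_cst _ cK (haar_carrier mK)).
by apply: eq_cintegral => k /set_mem /uk.
Qed.

Lemma char_op_idem u : P (P u) = P u.
Proof.
apply/val_inj/funext => x; apply: char_op_id => k.
exact: char_op_equivariant.
Qed.

Lemma nsq_char_op u x :
  nsq (P u x) <= \int[mK]_(k in K) nsq (u (x * k)%g).
Proof.
apply: le_trans (nsq_cintegral cK (haar_carrier mK) (@within u x)) _.
rewrite le_eqVlt; apply/orP; left; apply/eqP/eq_Rintegral => k /set_mem Kk.
by rewrite nsqM (nsq_norm1 (mchar_norm rho Kk)) mulr1.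
Qed.

End character_operator.

(** * The energy *)

Section energy.
Context {R : realType} {G : lcGroupType} (L : csubgroup G) (mL : haar R L).
Implicit Types u v w : C0 R G.

Let cL : compact (L : set G). Proof. exact: csubgroup_compact. Qed.

(* The squared L^2 norm, with an inversion that makes the left invariance of
   [mL] an invariance under right translations of [u]. *)
Definition energy u : R := \int[mL]_(x in L) nsq (u (x^-1)%g).

(** Twice the real part of the L^2 inner product: the linear coefficient in [energyD]. *)
Definition cross u v : R := \int[mL]_(x in L)
  (2 * (complex.Re (u (x^-1)%g) * complex.Re (v (x^-1)%g) +
        complex.Im (u (x^-1)%g) * complex.Im (v (x^-1)%g))).

Lemma inv_continuous u : continuous (fun x => u (x^-1)%g).
Proof.
move=> x; apply: (@cvg_comp _ _ _ (fun x : G => (x^-1)%g) u).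
  exact: invg_continuous.
exact: C0_continuous.
Qed.

Lemma nsq_inv_continuous u : continuous (fun x => nsq (u (x^-1)%g)).
Proof. by apply: nsq_continuous; exact: inv_continuous. Qed.

Lemma cross_continuous u v : continuous (fun x =>
  (2 * (complex.Re (u (x^-1)%g) * complex.Re (v (x^-1)%g) +
        complex.Im (u (x^-1)%g) * complex.Im (v (x^-1)%g))) : R).
Proof.
have cR w : continuous (fun x => complex.Re (w (x^-1)%g)).
  move=> x; apply: (@cvg_comp _ _ _ (fun x => w (x^-1)%g) (@complex.Re R)).
    exact: inv_continuous.
  exact: Re_continuous.
have cI w : continuous (fun x => complex.Im (w (x^-1)%g)).
  move=> x; apply: (@cvg_comp _ _ _ (fun x => w (x^-1)%g) (@complex.Im R)).
    exact: inv_continuous.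
  exact: Im_continuous.
move=> x; apply: cvgM; first exact: cvg_cst.
apply: (@cvgD _ R^o); first by apply: cvgM; exact: cR.
by apply: cvgM; exact: cI.
Qed.

Lemma energy_ge0 u : 0 <= energy u.
Proof. by apply: Rintegral_ge0 => x _; exact: nsq_ge0. Qed.

Lemma eq_energy u v : (forall x, (L : set G) x -> u x = v x) ->
  energy u = energy v.
Proof.
have [_ _ LV] := csubgroup_subgroup L.
by move=> uv; apply: eq_Rintegral => x /set_mem /LV /uv ->.
Qed.

Lemma energyD u v (a : R) :
  energy (u + a%:C%C *: v) = energy u + a * cross u v + a ^+ 2 * energy v.
Proof.
have cw (f : G -> R) : continuous f -> {within (L : set G), continuous f}.
  exact: continuous_subspaceT.
have c1 := cw _ (@nsq_inv_continuous u).
have c2 := cw _ (@cross_continuous u v).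
have c3 := cw _ (@nsq_inv_continuous v).
rewrite /energy /cross -Rintegral_comb// -Rintegral_comb//; last first.
  exact: within_comb.
apply: eq_Rintegral => x _.
rewrite [in LHS](_ : (u + a%:C%C *: v) (x^-1)%g =
  u (x^-1)%g + a%:C%C * v (x^-1)%g)//.
case: (u _) => p q; case: (v _) => r s; rewrite /nsq /=; ring.
Qed.

Lemma energyZ v (a : R) : energy (a%:C%C *: v) = a ^+ 2 * energy v.
Proof.
rewrite /energy -RintegralZl; [|exact: compact_borel|]; last first.
  apply: within_integrable => //; apply: continuous_subspaceT.
  exact: nsq_inv_continuous.
apply: eq_Rintegral => x _; rewrite (_ : nsq _ = nsq (a%:C%C * v (x^-1)%g))//.
by rewrite nsqM {1}/nsq/= expr0n/= addr0.
Qed.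

Lemma cross_diag u : cross u u = 2 * energy u.
Proof.
apply/eqP; rewrite -subr_eq0 -oppr_eq0; apply/eqP.
(* At [a = -1] the left-hand side is the energy of zero. *)
have := energyD u u (-1).
rewrite (_ : u + _ = 0%:C%C *: u); last first.
  by rewrite rmorphN rmorph1 rmorph0 scaleN1r subrr scale0r.
by rewrite energyZ => /eqP; rewrite eq_sym => /eqP h; lra.
Qed.

(* If [energy w = 0] then some finite sum of translates of [|w|^2] is bounded
   below on [L] and has integral zero. *)
Lemma energy_eq0 w : energy w = 0 -> forall x, (L : set G) x -> w x = 0.
Proof.
have [L1 LM LV] := csubgroup_subgroup L => w0 x Lx.
apply: nsq_eq0; apply: contrapT => wx.
pose f y := nsq (w (y^-1)%g); pose d := f (x^-1)%g.
have d0 : 0 < d.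
  by rewrite lt_def /d /f invgK nsq_ge0 andbT; apply/eqP.
have cf : continuous f by exact: nsq_inv_continuous.
pose B (y : G) : set G := [set z | d / 2 < f (y * z)%g].
have oB y : open (B y).
  have cfy : continuous (fun z => f (y * z)%g).
    move=> z; apply: (@cvg_comp _ _ _ (fun z => (y * z)%g) f).
      exact: mulgl_continuous.
    exact: cf.
  by have /continuousP := cfy; move/(_ _ (@open_gt R (d / 2))).
have := cL; rewrite compact_cover => /(_ _ (L : set G) B).
case=> [y _|z Lz|D DL LD]; first exact: oB.
  (* This [y] satisfies [y * z = x^-1], the point where [f] takes the value [d]. *)
  exists (x^-1 * z^-1)%g; first by apply: LM; exact: LV.
  by rewrite /B /= mulgVK -/d ltr_pdivrMr// ltr_pMr// ltr1n.
have [S [cS S0 Sf Sge]] : exists S : G -> R, [/\ continuous S,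
    \int[mL]_(z in L) S z = 0, forall z, 0 <= S z &
    forall z y, y \in finmap.enum_fset D -> f (y * z)%g <= S z].
  have: forall y, y \in finmap.enum_fset D -> (L : set G) y.
    by move=> y /DL /set_mem.
  elim: (finmap.enum_fset D) => [|y r IH] rL.
    exists (fun=> 0); split=> //; first exact: cst_continuous.
    by rewrite Rintegral_prob_cst//; exact: haar_carrier.
  have [t tr|S [cS S0 Sf Sge]] := IH.
    by apply: rL; rewrite inE tr orbT.
  have Ly : (L : set G) y by apply: rL; rewrite inE eqxx.
  have cfy : continuous (fun z => f (y * z)%g).
    move=> z; apply: (@cvg_comp _ _ _ (fun z => (y * z)%g) f).
      exact: mulgl_continuous.
    exact: cf.
  exists (fun z => S z + 1 * f (y * z)%g); split.
  - move=> z; apply: (@cvgD _ R^o); first exact: cS.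
    by apply: cvgM; [exact: cvg_cst|exact: cfy].
  - rewrite Rintegral_comb//; try exact: continuous_subspaceT.
    rewrite S0 (Rintegral_translate mL Ly); last exact: continuous_subspaceT.
    by rewrite add0r mul1r.
  - by move=> z; rewrite addr_ge0// mul1r nsq_ge0.
  - move=> z t; rewrite inE => /predU1P[->|/Sge tS].
      by rewrite mul1r lerDr.
    by rewrite mul1r (le_trans (tS z))// lerDl nsq_ge0.
have : d / 2 <= \int[mL]_(z in L) S z.
  rewrite -[leLHS](Rintegral_prob_cst _ cL (haar_carrier mL)).
  apply: ler_Rintegral => //.
  - by apply: continuous_subspaceT; exact: cst_continuous.
  - exact: continuous_subspaceT.
  - move=> z /LD[y /= yD] /= Byz; apply: le_trans (ltW Byz) _; exact: Sge.
by rewrite S0 leNgt divr_gt0.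
Qed.

End energy.

Section energy_contraction.
Context {R : realType} {G : lcGroupType} (L : csubgroup G) (mL : haar R L).
Context (K : csubgroup G) (mK : haar R K) (rho : mchar R K).
Hypothesis KL : (K : set G) `<=` L.
Implicit Types u : C0 R G.

Let P u := convol_fun (char_meas mK rho) u.

(** By [nsq_char_op] the energy of [P u] is at most a double integral of [h]. Integrated over [L]
    first, [h] gives [energy mL u] for every [k] in [K], as [K] lies in [L]; [average_approx]
    exchanges the two integrals up to [e]. *)
Lemma energy_char_op u : energy mL (P u) <= energy mL u.
Proof.
have cK : compact (K : set G) by exact: csubgroup_compact.
have cL : compact (L : set G) by exact: csubgroup_compact.
have [_ _ KV] := csubgroup_subgroup K.
apply/ler_addgt0Pr => e e0.
pose h (x k : G) := nsq (u (x^-1 * k)%g).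
have ch : continuous (fun p : G * G => h p.1 p.2).
  apply: nsq_continuous => p.
  apply: (@cvg_comp _ _ _ (fun p : G * G => (p.1^-1 * p.2)%g) u);
    last exact: C0_continuous.
  apply: cvgMg; last exact: cvg_snd.
  apply: (@cvg_comp _ _ _ fst (fun x : G => (x^-1)%g)); first exact: cvg_fst.
  exact: invg_continuous.
have hc k : (K : set G) k -> \int[mL]_(x in L) h x k = energy mL u.
  move=> Kk.
  have cu : {within (L : set G), continuous (fun x => nsq (u (x^-1)%g))}.
    by apply: continuous_subspaceT; exact: nsq_inv_continuous.
  rewrite /energy -(Rintegral_translate mL (KL (KV _ Kk)) cu).
  by apply: eq_Rintegral => x _; rewrite /h invgM invgK.
have [s [cs sc sh]] := average_approx cL cK (haar_carrier mK) ch hc e0.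
have ce : continuous (fun x => s x + 1 * e).
  by move=> x; apply: (@cvgD _ R^o); [exact: cs|exact: cvg_cst].
have -> : energy mL u + e = \int[mL]_(x in L) (s x + 1 * e).
  rewrite Rintegral_comb//.
  - by rewrite sc mul1r Rintegral_prob_cst//; exact: haar_carrier.
  - exact: continuous_subspaceT.
  - by apply: continuous_subspaceT; exact: cst_continuous.
apply: ler_Rintegral => //.
- by apply: continuous_subspaceT; exact: nsq_inv_continuous.
- exact: continuous_subspaceT.
move=> x Lx; rewrite mul1r; apply: le_trans (nsq_char_op mK rho u (x^-1)%g) _.
by rewrite -lerBlDl (le_trans (ler_norm _))// sh.
Qed.

(* The parallelogram law: [u] and [P u] have the same energy, which is also at
   most that of their midpoint. *)
Lemma energy_char_op_eq u : energy mL (P u) = energy mL u ->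
  forall x, (L : set G) x -> P u x = u x.
Proof.
move=> Pu x Lx; apply/eqP; rewrite -subr_eq0; apply/eqP.
suff /(@energy_eq0 _ _ _ mL)/(_ x Lx) : energy mL (P u + (-1)%:C%C *: u) = 0.
  by rewrite rmorphN rmorph1 scaleN1r.
apply/eqP; rewrite eq_le energy_ge0 andbT.
(* As [P (P u + u) = 2 P u], with [E] the common energy this reads [4 E <= 2 E + cross (P u) u],
   while the energy of [P u - u] is [2 E - cross (P u) u]. *)
have := energy_char_op (P u + 1%:C%C *: u).
have -> : P (P u + 1%:C%C *: u) = P u + 1%:C%C *: P u.
  rewrite (_ : P u + _ = 1 *: P u + u); last by rewrite rmorph1 !scale1r.
  by rewrite /P convol_funP char_op_idem rmorph1 !scale1r.
rewrite !energyD cross_diag Pu !expr1n sqrrN expr1n !mul1r.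
lra.
Qed.

End energy_contraction.

(** * Limits of bounded functions along ultrafilters *)

Section ultralimits.
Context {R : realType} {T : Type} (F : set_system T) {UF : UltraFilter F}.

(** Compactness of the segment gives a cluster point, and a cluster point of an ultrafilter is a
    limit. *)
Lemma ultra_cvg_bounded (f : T -> R) (M : R) :
  (forall x, `|f x| <= M) -> exists p : R, f @ F --> p.
Proof.
move=> fM; have /(_ (f @ F) _) := @segment_compact R (- M) M.
case=> [|p [_ clp]].
  by apply: (@filterE _ F) => x /=; rewrite in_itv/= -ler_norml.
exists p => A Ap; have [//|FnA] := in_ultra_setVsetC (f @^-1` A) UF.
by have [y [/= nA Ay]] := clp (~` A) A FnA Ap.
Qed.

Lemma ultra_cvg_complex (f : T -> R[i]) (b : R[i]) :
  (forall x, `|f x| <= b) -> exists p : R[i], f @ F --> p.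
Proof.
move=> fb.
have [p fp] := ultra_cvg_bounded (fun x => Re_le (fb x)).
have [q fq] := ultra_cvg_bounded (fun x => Im_le (fb x)).
have cRC : continuous (fun a : R => (a%:C)%C).
  move=> a; apply/(@pseudometric_normed_Zmodule.cvgrPdist_lt _ R[i]) => e e0.
  have Re0 : 0 < complex.Re e by move: e0; rewrite ltcE => /andP[].
  apply: filterS (@nbhsx_ballx R R a _ Re0) => c ac.
  rewrite -rmorphB/= normc_def/= expr0n/= addr0 sqrtr_sqr.
  by rewrite -(RRe_real (gtr0_real e0)) ltcR.
exists (p%:C + 'i * q%:C)%C.
rewrite (_ : f = fun x => (complex.Re (f x))%:C + 'i * (complex.Im (f x))%:C)%C.
  apply: cvgD; last (apply: cvgM; first exact: cvg_cst).
    by apply: (@cvg_comp _ _ _ (fun x => complex.Re (f x)) _ _ (nbhs p));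
      [exact: fp|exact: cRC].
  by apply: (@cvg_comp _ _ _ (fun x => complex.Im (f x)) _ _ (nbhs q));
    [exact: fq|exact: cRC].
by apply/funext => x; rewrite -complexE.
Qed.

End ultralimits.

Lemma cvg_norm_le (R : realType) (T : Type) (F : set_system T)
    {PF : ProperFilter F} (f : T -> R[i]) (p b : R[i]) :
  f @ F --> p -> (\forall x \near F, `|f x| <= b) -> `|p| <= b.
Proof.
move=> fp fb; apply/ler_addgt0Pr => e e0.
have FF : Filter F by exact: filter_filter.
have fe :=
  (@pseudometric_normed_Zmodule.cvgrPdist_lt _ R[i] T F FF f p).1 fp e e0.
have [x [/= bx ex]] := filter_ex (filterI fb fe).
rewrite -(subrK (f x) p) (le_trans (ler_normD _ _))// addrC lerD//.
exact: ltW.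
Qed.

Lemma energy_cvg (R : realType) (G : lcGroupType) (L : csubgroup G)
    (mL : haar R L) (T : Type) (F : set_system T) {FF : Filter F}
    (b : T -> C0 R G) (g : C0 R G) :
  (forall e : R, 0 < e ->
    \forall n \near F, forall x, (L : set G) x -> `|b n x - g x| <= (e%:C)%C) ->
  energy mL (b n) @[n --> F] --> energy mL g.
Proof.
have [L1 _ LV] := csubgroup_subgroup L.
have cL : compact (L : set G) by exact: csubgroup_compact.
move=> bg; have [B B0 gB] := C0_bounded g.
set M := complex.Re B.
have M0 : 0 < M by move: B0; rewrite ltcE => /andP[].
apply/(@pseudometric_normed_Zmodule.cvgrPdist_le _ R^o) => e e0.
(* If [b n - g] is at most [d] on [L], the cross term is at most [4 * M * d] and the quadratic term
   at most [d ^+ 2 <= d]; their sum is at most [e]. *)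
pose d := Num.min 1 (e / (4 * M + 1)).
have d0 : 0 < d by rewrite lt_min ltr01 divr_gt0// addr_gt0// mulr_gt0.
have d1 : d <= 1 by rewrite ge_min lexx.
have dM : d * (4 * M + 1) <= e.
  by rewrite -ler_pdivlMr ?ge_min ?lexx ?orbT// addr_gt0// mulr_gt0.
apply: filterS (bg d d0) => n bn.
pose w := b n - g.
have bE : b n = g + (1 : R)%:C%C *: w.
  by rewrite rmorph1 scale1r /w addrC subrK.
have wd x : (L : set G) x -> `|w x| <= (d%:C)%C by exact: bn.
have wR x : (L : set G) x -> `|complex.Re (w x)| <= d by move/wd/Re_le.
have wI x : (L : set G) x -> `|complex.Im (w x)| <= d by move/wd/Im_le.
have gR x : `|complex.Re (g x)| <= M by exact/Re_le.
have gI x : `|complex.Im (g x)| <= M by exact/Im_le.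
rewrite bE energyD mul1r expr1n mul1r -addrA opprD addrA subrr add0r normrN.
apply: le_trans (ler_normD _ _) _.
apply: le_trans dM; rewrite mulrDr mulr1 lerD//.
  apply: Rintegral_le => //.
  - by apply: continuous_subspaceT; exact: cross_continuous.
  - move=> x /LV Lx; rewrite normrM ger0_norm//.
    rewrite (_ : d * (4 * M) = 2 * (M * d + M * d)); last by ring.
    rewrite ler_pM2l//; apply: le_trans (ler_normD _ _) _.
    by rewrite !normrM lerD// ler_pM// ?wR ?wI.
  - by rewrite !mulr_ge0// ltW.
apply: Rintegral_le => //; last exact: ltW.
- by apply: continuous_subspaceT; exact: nsq_inv_continuous.
- move=> x /LV Lx; rewrite ger0_norm ?nsq_ge0// (@le_trans _ _ (d ^+ 2))//.
    by rewrite -lecR nsqE rmorphXn/= lerXn2r ?nnegrE ?wd// lecR ltW.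
  by rewrite expr2 ler_piMl// ltW.
Qed.

(** * Iterates *)

Section iterates.
Context {R : realType} {G : lcGroupType} (L : csubgroup G) (mL : haar R L).
Variable mu : cmeas R G.
Implicit Types u v g : C0 R G.

Let T := convol_fun mu.

Hypothesis T_le : forall u (b : R[i]),
  (forall x, (L : set G) x -> `|u x| <= b) ->
  forall x, (L : set G) x -> `|T u x| <= b.
Hypothesis T_energy : forall u, energy mL (T u) <= energy mL u.

Let a u n := iter n T u.

Let aB u v n : a (u - v) n = a u n - a v n.
Proof.
elim: n => // n; rewrite /a !iterS => ->.
by rewrite addrC -scaleN1r /T convol_funP scaleN1r addrC.
Qed.

Let a_translate x u n : a (translate x u) n = translate x (a u n).
Proof.
by elim: n => // n; rewrite /a !iterS => ->; exact: convol_fun_translate.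
Qed.

Let a_le u (b : R[i]) n : (forall x, (L : set G) x -> `|u x| <= b) ->
  forall x, (L : set G) x -> `|a u n x| <= b.
Proof. by move=> ub; elim: n => // n IH; exact: T_le. Qed.

(** Iterates commute with left translations, so the contraction on [L], read at 1 for
    [translate x u], becomes one on the coset of [x]. *)
Let a_le1 u (b : R[i]) x n :
  (forall y, (L : set G) y -> `|u (x * y)%g| <= b) -> `|a u n x| <= b.
Proof.
move=> ub; have [L1 _ _] := csubgroup_subgroup L.
have := @a_le (translate x u) b n ub 1%g L1.
by rewrite a_translate /= mulg1.
Qed.

Let a_equicontinuous u (e : R[i]) : 0 < e ->
  \forall v \near (1%g : G), forall n x, `|a u n x - a u n (v * x)%g| <= e.
Proof.
move=> e0; apply: filterS (C0_uniform u e0) => v uv n x.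
have -> : a u n x - a u n (v * x)%g = a (u - translate v u) n x.
  by rewrite aB a_translate.
by apply: a_le1 => y _; apply: ltW; exact: uv.
Qed.

(** An ultrafilter [F] finer than [\oo] serves as the subnet. Pointwise limits along [F] exist by
    boundedness, and equicontinuity makes them uniform on [L]. The energies at [n] and [n.+1] have
    the same limit, which is therefore the energy of both [g] and [T g]. *)
Lemma iter_limit u : exists2 g, energy mL (T g) = energy mL g &
  forall e : R, 0 < e -> exists n,
    forall x, (L : set G) x -> `|iter n T u x - g x| <= (e%:C)%C.
Proof.
have cL : compact (L : set G) by exact: csubgroup_compact.
have [L1 LM LV] := csubgroup_subgroup L.
have [F [UF Foo]] := @ultraFilterLemma nat \oo _.
have [b b0 ub] := C0_bounded u.
have /choice[g0 ag0] : forall x, exists p : R[i], a u n x @[n --> F] --> p.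
  move=> x; apply: (@ultra_cvg_complex _ _ _ _ _ b) => n.
  by apply: a_le1 => y _.
have g0_equi (e : R[i]) : 0 < e ->
    \forall v \near (1%g : G), forall x, `|g0 x - g0 (v * x)%g| <= e.
  move=> e0; apply: filterS (a_equicontinuous u e0) => v uv x.
  apply: (@cvg_norm_le _ _ F _ (fun n => a u n x - a u n (v * x)%g)).
    by apply: cvgB; exact: ag0.
  exact: nearW.
have near_g (P : G -> Prop) x : (\forall v \near (1%g : G), P v) ->
    \forall y \near x, P (y * x^-1)%g.
  have vx : (y * x^-1)%g @[y --> x] --> (1%g : G).
    by have := @mulgr_continuous _ (x^-1)%g x; rewrite /continuous_at mulgV.
  by move/vx.
have cg0 : continuous g0.
  move=> x; apply/(@pseudometric_normed_Zmodule.cvgrPdist_le _ R[i]) => e e0.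
  apply: filterS (near_g _ x (g0_equi e e0)) => y /(_ x).
  by rewrite mulgVK.
have g0C0 : g0 \in @C0_pred R G.
  apply/asboolP; split => // e e0.
  have e2 : 0 < e / 2 by rewrite divr_gt0.
  (* If [|u|] is below [e / 2] on the whole coset [x L], so are the iterates at [x], and
     [|g0 x| <= e / 2]. Hence the level set of [g0] lies in the product of a level set of [u] with
     [L]. *)
  apply: (subclosed_compact _ (mulg_compact (C0_compact (u := u) e2) cL)).
    exact: closed_level.
  move=> x /= ex; apply: contrapT => nx.
  suff : `|g0 x| <= e / 2.
    move=> /(le_trans ex); rewrite ler_pdivlMr// ger_pMr//.
    by rewrite lern1.
  apply: (@cvg_norm_le _ _ F _ (fun n => a u n x)); first exact: ag0.
  apply: nearW => n; apply: a_le1 => y Ly; apply: ltW.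
  apply: level_Nge => // exy; apply: nx.
  by exists ((x * y)%g, (y^-1)%g); rewrite /= ?mulgK//; split=> //; exact: LV.
pose g := MkC0 g0C0.
(* Near each [x] of [L], three errors of [e / 3]: equicontinuity of the iterates, that of [g0], and
   convergence at [x] itself. *)
have ag (e : R) : 0 < e ->
    \forall n \near F, forall x, (L : set G) x -> `|a u n x - g x| <= (e%:C)%C.
  move=> e0; have /compact_near_coveringP := cL.
  apply => x Lx.
  have e3 : 0 < (e%:C)%C / 3 by rewrite divr_gt0// ltcR.
  have FF : Filter F by exact: filter_filter.
  near=> y n => /=.
  have h1 : forall n z, `|a u n z - a u n ((y * x^-1) * z)%g| <= (e%:C)%C / 3.
    near: y; exact: near_g (a_equicontinuous u e3).
  have h2 : forall z, `|g0 z - g0 ((y * x^-1) * z)%g| <= (e%:C)%C / 3.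
    near: y; exact: near_g (g0_equi _ e3).
  have h3 : `|g0 x - a u n x| <= (e%:C)%C / 3.
    near: n; exact: (@pseudometric_normed_Zmodule.cvgrPdist_le _ R[i] nat F FF
      (fun n => a u n x) (g0 x)).1 (ag0 x) _ e3.
  have {h1}:= h1 n x; have {h2}:= h2 x; rewrite !mulgVK => h2 h1.
  apply: le_trans (ler_distD (a u n x) _ _) _.
  apply: le_trans (lerD (lexx _) (ler_distD (g0 x) _ _)) _.
  rewrite distrC [X in _ + (X + _)]distrC (_ : (e%:C)%C =
    (e%:C)%C / 3 + ((e%:C)%C / 3 + (e%:C)%C / 3)); last by field.
  by rewrite !lerD.
have FF : Filter F by exact: filter_filter.
exists g; last first.
  by move=> e e0; have [n] := filter_ex (ag e e0); exists n.
have cE : cvgn (fun n => energy mL (a u n)).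
  apply: nonincreasing_is_cvgn.
    by apply/nonincreasing_seqP => n; exact: T_energy.
  by exists 0 => _ [n _ <-]; exact: energy_ge0.
have E0 : energy mL (a u n) @[n --> F] --> lim (energy mL (a u n) @[n --> \oo]).
  by move=> A /cE; exact: Foo.
have E1 : energy mL (a u n.+1) @[n --> F] -->
    lim (energy mL (a u n) @[n --> \oo]).
  have cE1 := cE; rewrite /= -(cvg_shiftS (fun n => energy mL (a u n))) in cE1.
  by move=> A /cE1; exact: Foo.
have -> : energy mL g = lim (energy mL (a u n) @[n --> \oo]).
  apply: (@cvg_unique _ (@Rhausdorff R) (energy mL (a u n) @[n --> F])) => //.
  exact: energy_cvg.
apply: (@cvg_unique _ (@Rhausdorff R) (energy mL (a u n.+1) @[n --> F])) => //.
apply: energy_cvg => e e0; apply: filterS (ag e e0) => n agn x Lx.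
have -> : a u n.+1 x - T g x = T (a u n - g) x.
  by rewrite (_ : T (a u n - g) = T (a u n) - T g)//; exact: (aB (a u n) g 1).
by apply: T_le Lx => y Ly; exact: agn.
Unshelve. all: by end_near. Qed.

(** [T] contracts distances on [L] and fixes [g] there, so an iterate within [e] of [g] is followed
    only by such iterates. *)
Lemma iter_cvg u g : (forall x, (L : set G) x -> T g x = g x) ->
  (forall e : R, 0 < e -> exists n,
    forall x, (L : set G) x -> `|iter n T u x - g x| <= (e%:C)%C) ->
  forall e : R, 0 < e -> \forall n \near \oo,
    forall x, (L : set G) x -> `|iter n T u x - g x| <= (e%:C)%C.
Proof.
move=> Tg + e e0 => /(_ e e0)[n0 n0P]; exists n0 => // n /= n0n.
rewrite -(subnK n0n); elim: (n - n0)%N => // k IH x Lx.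
rewrite addSn iterS.
have -> : T (iter (k + n0) T u) x - g x = T (iter (k + n0) T u - g) x.
  rewrite -(Tg _ Lx) (_ : T (_ - g) = T (iter (k + n0) T u) - T g)//.
  exact: (aB (iter (k + n0) T u) g 1).
exact: T_le.
Qed.

End iterates.

(** * Products of several character operators *)

Section character_products.
Context {R : realType} {G : lcGroupType} (L : csubgroup G) (mL : haar R L).
Context (I : eqType) (K : I -> csubgroup G) (mK : forall j, haar R (K j)).
Context (rho : forall j, mchar R (K j)).
Hypothesis KL : forall j, (K j : set G) `<=` L.
Implicit Types (u g : C0 R G) (r : seq I).

Let P j u := convol_fun (char_meas (mK j) (rho j)) u.
(** The product runs over a sequence [r] so that one factor can be peeled off at a time. *)
Let T r :=
  convol_fun (\big[convol/diracm 1%g]_(j <- r) char_meas (mK j) (rho j)).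

Let T_nil u : T [::] u = u.
Proof. by rewrite /T big_nil convol_fun1. Qed.

Let T_cons j r u : T (j :: r) u = P j (T r u).
Proof. by rewrite /T big_cons convol_fun_convol. Qed.

Lemma char_prod_le r u (b : R[i]) : (forall x, (L : set G) x -> `|u x| <= b) ->
  forall x, (L : set G) x -> `|T r u x| <= b.
Proof.
have [_ LM _] := csubgroup_subgroup L.
move=> ub; elim: r => [|j r IH] x Lx; first by rewrite T_nil ub.
by rewrite T_cons; apply: char_op_le => k /KL Lk; apply: IH; exact: LM.
Qed.

Lemma energy_char_prod r u : energy mL (T r u) <= energy mL u.
Proof.
elim: r => [|j r IH]; first by rewrite T_nil.
by rewrite T_cons (le_trans (energy_char_op mL _ _ (@KL j) _)).
Qed.

Lemma char_prod_id r g :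
  (forall j, j \in r -> forall x, (L : set G) x -> P j g x = g x) ->
  forall x, (L : set G) x -> T r g x = g x.
Proof.
have [_ LM _] := csubgroup_subgroup L.
elim: r => [|j r IH] Pg x Lx; first by rewrite T_nil.
rewrite T_cons -[RHS](Pg j _ _ Lx) ?inE ?eqxx//.
apply: eq_cintegral => k /set_mem /KL Lk; congr (_ * _).
apply: IH; last exact: LM.
by move=> i ir; apply: Pg; rewrite inE ir orbT.
Qed.

(** No factor increases the energy, so equality for the product forces it for the tail [r]. By
    induction the tail fixes [g] on [L]; then [P j g] has the energy of [g], and [energy_char_op_eq]
    applies to the head. *)
Lemma energy_char_prod_eq r g : energy mL (T r g) = energy mL g ->
  forall j, j \in r -> forall x, (L : set G) x -> P j g x = g x.
Proof.
have [_ LM _] := csubgroup_subgroup L.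
elim: r => // j r IH; rewrite T_cons => Eg.
have ETr : energy mL (T r g) = energy mL g.
  apply/le_anti/andP; split; first exact: energy_char_prod.
  by rewrite -Eg; exact: (energy_char_op mL _ _ (@KL j)).
have Tg := char_prod_id (IH ETr).
have PTg x : (L : set G) x -> P j (T r g) x = P j g x.
  move=> Lx; apply: eq_cintegral => k /set_mem /KL Lk; congr (_ * _).
  by apply: Tg; exact: LM.
move=> i; rewrite inE => /predU1P[->|/(IH ETr)//].
apply: (energy_char_op_eq (mL := mL) (@KL j)); rewrite -Eg.
by apply: eq_energy => x /PTg.
Qed.

End character_products.

Lemma affine_ge0 (R : realType) (p q : R) : (forall s, 0 <= p + s * q) -> q = 0.
Proof.
move=> h; apply/eqP; apply: contraT => q0.
by have := h (- (p + 1) / q); rewrite divfK// opprD addrA subrr add0r ler0N1.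
Qed.

Lemma closed_within_eq (T : topologicalType) (U : topologicalType) (A : set T)
    (f : T -> U) (c : U) : hausdorff_space U -> closed A ->
  {within A, continuous f} -> closed (A `&` [set x | f x = c]).
Proof.
move=> hU cA /continuous_closedP cf.
have cc : closed [set c].
  by apply: accessible_closed_set1; exact: hausdorff_accessible.
have /closed_subspaceP[V cV VA] := cf _ cc.
by rewrite setIC -[X in closed X]VA; exact: closedI.
Qed.

Lemma complex_hausdorff (R : realType) :
  hausdorff_space (R[i] : topologicalType).
Proof. exact: (@norm_hausdorff _ R[i]). Qed.

Lemma prod_set_sub (G : lcGroupType) (m : nat) (K : 'I_m -> csubgroup G) j :
  (K j : set G) `<=` prod_set (fun j => K j : set G).
Proof.
move=> x Kx; exists (fun i => if i == j then x else 1%g) => [i|].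
  by case: eqP => [->//|_]; case: (csubgroup_subgroup (K i)).
by rewrite (@big_only1 _ _ _ _ j) ?eqxx// => i /negbTE->.
Qed.

Lemma closed_subgroup_gen_min (G : lcGroupType) (m : nat)
    (K : 'I_m -> csubgroup G) (H : set G) : subgroup H -> closed H ->
  (forall j, (K j : set G) `<=` H) ->
  closed_subgroup_gen (prod_set (fun j => K j : set G)) `<=` H.
Proof.
move=> sH cH KH; have [H1 HM _] := sH.
apply: smallest_sub => // _ [k kK <-].
by elim/big_ind : _ => // j _; exact/KH/kK.
Qed.

(** * Characters from equivariant functions *)

Section equivariant_functions.
Context {R : realType} {G : lcGroupType} (L : csubgroup G).
Implicit Types g : C0 R G.

Lemma mchar1 (chi : mchar R L) : chi 1%g = 1.
Proof.
have [L1 _ _] := csubgroup_subgroup L.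
have c0 : chi 1%g != 0 by rewrite -normr_eq0 (mchar_norm chi L1) oner_eq0.
by apply: (mulfI c0); rewrite mulr1 -mchar_morph// mulg1.
Qed.

Let closedL : closed (L : set G).
Proof.
by apply: compact_closed; [exact: lcg_hausdorff|exact: csubgroup_compact].
Qed.

Let Lbigcap (A : G -> set G) :
  (forall x, (L : set G) x -> closed ((L : set G) `&` A x)) ->
  closed ((L : set G) `&` [set h | forall x, (L : set G) x -> A x h]).
Proof.
have [L1 _ _] := csubgroup_subgroup L.
move=> cA.
rewrite (_ : _ `&` _ = \bigcap_(x in L : set G) ((L : set G) `&` A x)).
  exact: closed_bigI.
apply/seteqP; split=> [h [Lh Ah] x Lx|h hA]; first by split=> //; exact: Ah.
by split=> [|x /hA[]//]; have [] := hA _ L1.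
Qed.

Let within_mul g (x : G) (f : G -> R[i]) : {within (L : set G), continuous f} ->
  {within (L : set G), continuous (fun h => g (x * h)%g * f h)}.
Proof.
move=> cf.
have cg : {within (L : set G), continuous (fun h => g (x * h)%g)}.
  by apply: continuous_subspaceT; exact: (@C0_continuous _ _ (translate x g)).
by move=> h; apply: cvgM; [exact: cg|exact: cf].
Qed.

(** A closed subgroup containing every [K j] contains [L]; this carries equivariance from the [K j]
    over to [L]. *)
Lemma equivariant_subgroup (chi : mchar R L) g :
  let H := (L : set G) `&`
    [set h | forall x, (L : set G) x -> g (x * h)%g * chi h = g x] in
  subgroup H /\ closed H.
Proof.
have [L1 LM LV] := csubgroup_subgroup L.
move=> H; split; last first.
  apply: Lbigcap => x Lx.
  apply: (closed_within_eq (@complex_hausdorff R) closedL).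
  by apply: within_mul; exact: mchar_continuous.
split.
- by split=> // x _; rewrite mulg1 mchar1 mulr1.
- move=> h k [Lh gh] [Lk gk]; split=> [|x Lx]; first exact: LM.
  by rewrite mchar_morph// mulrCA mulrC mulgA gk ?gh//; exact: LM.
- move=> h [Lh gh]; split=> [|x Lx]; first exact: LV.
  rewrite -(gh (x * h^-1)%g); last by apply: LM => //; exact: LV.
  rewrite mulgVK -mulrA -mchar_morph ?mulgV ?mchar1 ?mulr1//; exact: LV.
Qed.

(** [H] consists of the [h] whose right translation multiplies [g] by the unimodular scalar
    [g h / g 1], written without division. The condition on [nsq] gives [g h != 0], which stability
    under inverses uses. *)
Lemma proportional_subgroup g : g 1%g != 0 ->
  let H := (L : set G) `&` [set h | nsq (g h) = nsq (g 1%g) /\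
    forall x, (L : set G) x -> g (x * h)%g * g 1%g = g h * g x] in
  subgroup H /\ closed H.
Proof.
have [L1 LM LV] := csubgroup_subgroup L.
move=> g1 H.
have ng1 : nsq (g 1%g) != 0.
  by apply: contra_neq g1 => /nsq_eq0.
have cg : {within (L : set G), continuous g}.
  by apply: continuous_subspaceT; exact: C0_continuous.
split; last first.
  rewrite (_ : H = ((L : set G) `&` [set h | nsq (g h) = nsq (g 1%g)]) `&`
    ((L : set G) `&` [set h | forall x, (L : set G) x ->
       g (x * h)%g * g 1%g = g h * g x])); last first.
    by apply/seteqP; split=> [h [Lh []]|h [[Lh ?] [_ ?]]].
  apply: closedI.
    apply: (closed_within_eq (@Rhausdorff R) closedL).
    apply: continuous_subspaceT; apply: nsq_continuous.
    exact: C0_continuous.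
  apply: Lbigcap => x Lx.
  rewrite (_ : _ `&` _ = (L : set G) `&`
    [set h | g (x * h)%g * g 1%g - g h * g x = 0]).
    apply: (closed_within_eq (@complex_hausdorff R) closedL).
    move=> h; apply: cvgB.
      by apply: within_mul; apply: continuous_subspaceT; exact: cst_continuous.
    by apply: cvgM; [exact: cg|exact: cvg_cst].
  apply/seteqP; split=> h [Lh] /=; first by move=> ->; rewrite subrr.
  by move/eqP; rewrite subr_eq0 => /eqP.
split.
- by split=> //=; split=> // x _; rewrite mulg1 mulrC.
- move=> h k [Lh [nh gh]] [Lk [nk gk]]; split; first exact: LM.
  have ghk : g (h * k)%g * g 1%g = g k * g h by exact: gk.
  split=> [|x Lx].
    by apply: (mulIf ng1); rewrite -nsqM ghk nsqM nh nk.
  apply: (mulIf g1); rewrite mulgA gk; last exact: LM.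
  by rewrite -mulrA gh// mulrA -ghk mulrAC.
- move=> h [Lh [nh gh]]; split; first exact: LV.
  have gh0 : g h != 0.
    by apply: contra_neq ng1 => h0; rewrite -nh h0 /nsq/= expr0n/= addr0.
  have ghV : g 1%g * g 1%g = g h * g (h^-1)%g.
    by rewrite -(gh _ (LV _ Lh)) mulVg.
  split=> [|x Lx].
    by apply: (mulfI ng1); rewrite -{1}nh -!nsqM -ghV.
  have gx : g x * g 1%g = g h * g (x * h^-1)%g.
    by rewrite -(gh (x * h^-1)%g) ?mulgVK//; apply: LM => //; exact: LV.
  by apply: (mulfI gh0); rewrite mulrA -gx mulrA -ghV -mulrA mulrC.
Qed.

(** The inverse is there because [g k * rho j k = g 1] on [K j]: the multiplier [g k / g 1] is the
    reciprocal of [rho j k]. *)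
Lemma mchar_of_proportional g : g 1%g != 0 ->
  (forall h, (L : set G) h -> nsq (g h) = nsq (g 1%g) /\
    forall x, (L : set G) x -> g (x * h)%g * g 1%g = g h * g x) ->
  exists chi : mchar R L, forall h, chi h = g (h^-1)%g / g 1%g.
Proof.
have [L1 LM LV] := csubgroup_subgroup L.
move=> g1 gL.
have c1 : {within (L : set G), continuous (fun h => g (h^-1)%g / g 1%g)}.
  apply: continuous_subspaceT => h.
  by apply: cvgM; [exact: inv_continuous|exact: cvg_cst].
have c2 x y : (L : set G) x -> (L : set G) y ->
    g ((x * y)^-1)%g / g 1%g = g (x^-1)%g / g 1%g * (g (y^-1)%g / g 1%g).
  move=> /LV Lx /LV Ly; have [_ /(_ _ Ly) gx] := gL _ Lx.
  rewrite invgM mulrACA -gx -invfM invfM mulrA mulfK//.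
have c3 x : (L : set G) x -> `|g (x^-1)%g / g 1%g| = 1.
  move=> /LV/gL[nx _]; rewrite normrM normfV.
  have -> : `|g (x^-1)%g| = `|g 1%g|.
    by rewrite !normc_def -/(nsq _) -/(nsq (g 1%g)) nx.
  by rewrite divff// normr_eq0.
by exists (MkMchar c1 c2 c3).
Qed.

End equivariant_functions.

Lemma complex_cvg_le (R : realType) (T : Type) (F : set_system T)
    {FF : Filter F} (f : T -> R[i]) (p : R[i]) :
  (forall e : R, 0 < e -> \forall n \near F, `|f n - p| <= (e%:C)%C) ->
  f @ F --> p.
Proof.
move=> fp; apply/(@pseudometric_normed_Zmodule.cvgrPdist_le _ R[i]) => e e0.
have Re0 : 0 < complex.Re e by move: e0; rewrite ltcE => /andP[].
apply: filterS (fp _ Re0) => n.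
by rewrite distrC (RRe_real (gtr0_real e0)).
Qed.

(** * Identification of the limit *)

Section limit_identification.
Context {R : realType} {G : lcGroupType} (L : csubgroup G) (mL : haar R L).
Variable mu : cmeas R G.
Implicit Types u v g : C0 R G.

Let T := convol_fun mu.

Hypothesis T_le : forall u (b : R[i]),
  (forall x, (L : set G) x -> `|u x| <= b) ->
  forall x, (L : set G) x -> `|T u x| <= b.
Hypothesis T_energy : forall u, energy mL (T u) <= energy mL u.

Let iterP n (a : R[i]) u v :
  iter n T (a *: u + v) = a *: iter n T u + iter n T v.
Proof. by elim: n => // n IH; rewrite !iterS IH; exact: convol_funP. Qed.

Let iter_energy n u : energy mL (iter n T u) <= energy mL u.
Proof. by elim: n => // n IH; rewrite iterS (le_trans (T_energy _)). Qed.

(** The contraction on [L], applied to [u - v] with bound zero. *)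
Let T_eq u v : (forall x, (L : set G) x -> u x = v x) ->
  forall x, (L : set G) x -> T u x = T v x.
Proof.
move=> uv x Lx; apply/eqP; rewrite -subr_eq0 -normr_le0.
have -> : T u x - T v x = T (-1 *: v + u) x.
  by rewrite /T convol_funP scaleN1r addrC.
apply: T_le Lx => y Ly; rewrite normr_le0.
rewrite (_ : (-1 *: v + u) y = -1 * v y + u y)//.
by rewrite uv// mulN1r addNr.
Qed.

Let iter_fix n v : (forall x, (L : set G) x -> T v x = v x) ->
  forall x, (L : set G) x -> iter n T v x = v x.
Proof.
by move=> Tv; elim: n => // n IH x Lx; rewrite iterS -[RHS]Tv//; exact: T_eq.
Qed.

(* [g' = g - Q u] is both the limit of the iterates of [u' = u - Q u] and
   Q-invariant, whereas [Q u' = 0].  As [T] and [Q] decrease the energy,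
   [(1 + s)^2 E] and [s^2 E], with [E] the energy of [g'], are both bounded by
   the energy of [u' + s g'], a polynomial in [s] with leading term [s^2 E]; so
   its linear coefficient is both [2 E] and [0]. *)
Lemma iter_limit_char (chi : mchar R L) u g :
  let Q := convol_fun (char_meas mL chi) in
  (forall x, (L : set G) x -> Q g x = g x) ->
  (forall x, (L : set G) x -> T g x = g x) ->
  (forall x, (L : set G) x -> T (Q u) x = Q u x) ->
  (forall e : R, 0 < e -> \forall n \near \oo,
    forall x, (L : set G) x -> `|iter n T u x - g x| <= (e%:C)%C) ->
  forall x, (L : set G) x -> g x = Q u x.
Proof.
move=> Q Qg Tg TQ ug x Lx.
pose u' := -1 *: Q u + u; pose g' := -1 *: Q u + g.
pose E := energy mL g'.
pose w (s : R) := u' + (s%:C)%C *: g'.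
have Ew s : energy mL (w s) = energy mL u' + s * cross mL u' g' + s ^+ 2 * E.
  exact: energyD.
have QQ : Q (Q u) = Q u by exact: char_op_idem.
have wE s : w s = (s%:C)%C *: g' + u' by rewrite /w addrC.
have h1 s : (1 + s) ^+ 2 * E <= energy mL (w s).
  have lims : energy mL (iter n T (w s)) @[n --> \oo] -->
      energy mL ((1 + s)%:C%C *: g').
    apply: energy_cvg.
    move=> e /ug; apply: filterS => n ugn y Ly.
    (* On [L] the iterates of [T] fix [Q u] and [g], so all terms but these two cancel. *)
    rewrite (_ : _ - _ = iter n T u y - g y); first exact: ugn.
    rewrite wE !iterP.
    rewrite (_ : C0_fun _ y = (s%:C)%C * (-1 * iter n T (Q u) y + iter n T g y)
      + (-1 * iter n T (Q u) y + iter n T u y))//.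
    rewrite (iter_fix n TQ Ly) (iter_fix n Tg Ly).
    rewrite [X in _ - X](_ : _ = (1 + s)%:C%C * (-1 * Q u y + g y))//.
    by rewrite rmorphD rmorph1; ring.
  rewrite /E -energyZ -(cvg_lim (@Rhausdorff R) lims).
  apply: limr_le; first exact: cvgP lims.
  by apply: nearW => n; exact: iter_energy.
have h2 s : s ^+ 2 * E <= energy mL (w s).
  rewrite /E -energyZ.
  have -> : energy mL ((s%:C)%C *: g') = energy mL (Q (w s)).
    apply: eq_energy => y Ly; rewrite wE /Q !convol_funP -/Q QQ.
    rewrite [LHS](_ : _ = (s%:C)%C * (-1 * Q u y + g y))//.
    rewrite [RHS](_ : _ = (s%:C)%C * (-1 * Q u y + Q g y) +
      (-1 * Q u y + Q u y))//.
    by rewrite Qg// mulN1r addNr addr0.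
  exact: energy_char_op.
(* Once [s ^+ 2 * E] cancels in [h2] and [h1], what remains is affine in [s] and nonnegative for all
   [s], so its slope vanishes. *)
have c0 : cross mL u' g' = 0.
  apply: (@affine_ge0 _ (energy mL u')) => s; have := h2 s; rewrite Ew; lra.
have E0 : cross mL u' g' - 2 * E = 0.
  apply: (@affine_ge0 _ (energy mL u' - E)) => s; have := h1 s; rewrite Ew; lra.
have : E = 0 by lra.
move=> /energy_eq0 /(_ x Lx) /eqP.
rewrite (_ : g' x = g x - Q u x); first by rewrite subr_eq0 => /eqP.
by rewrite addrC -[in RHS]mulN1r.
Qed.

End limit_identification.

(** * The weak* limit of the convolution powers *)

Theorem theorem2p2 (R : realType) (G : lcGroupType) (m : nat)
    (K : 'I_m -> csubgroup G) (mK : forall j, haar R (K j))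
    (rho : forall j, mchar R (K j))
    (L : csubgroup G) (mL : haar R L) :
  (0 < m)%N ->
  closed_subgroup_gen (prod_set (fun j => K j : set G)) = L ->
  let mu := \big[convol/diracm 1%g]_(j < m) char_meas (mK j) (rho j) in
  let extends (chi : mchar R L) :=
    forall j x, (K j : set G) x -> chi x = rho j x in
  [/\ exists nu : cmeas R G, convol_pow mu n @[n --> \oo] --> nu,
      forall chi : mchar R L, extends chi ->
        convol_pow mu n @[n --> \oo] --> char_meas mL chi
    & ~ (exists chi : mchar R L, extends chi) ->
        convol_pow mu n @[n --> \oo] --> (zerom : cmeas R G)].
Proof.
move=> _ genL mu extends.
have [L1 LM LV] := csubgroup_subgroup L.
have KL j : (K j : set G) `<=` L.
  by rewrite -genL => x /prod_set_sub; exact: sub_gen_smallest.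
have genP (H : set G) : subgroup H -> closed H ->
    (forall j, (K j : set G) `<=` H) -> (L : set G) `<=` H.
  by move=> sH cH KH; rewrite -genL; exact: closed_subgroup_gen_min.
pose T := convol_fun mu.
have T_le := char_prod_le mK rho KL (index_enum 'I_m).
have T_energy := energy_char_prod mL mK rho KL (index_enum 'I_m).
pose P j := convol_fun (char_meas (mK j) (rho j)).
have limit (u : C0 R G) : exists2 g : C0 R G,
    (forall j x, (L : set G) x -> P j g x = g x) &
    (forall e : R, 0 < e -> \forall n \near \oo,
      forall x, (L : set G) x -> `|iter n T u x - g x| <= (e%:C)%C).
  have [g Eg ug] := iter_limit T_le T_energy u.
  have Pg j := energy_char_prod_eq KL Eg (mem_index_enum j).
  exists g => //; apply: (iter_cvg T_le) => //.
  by apply: (char_prod_id KL) => j _; exact: Pg.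
(* The n-th power at [u] is the n-th iterate at 1, a point of [L]; so only the value [g 1] remains
   to be identified. *)
have cvg1 (nu : cmeas R G) : (forall (u g : C0 R G),
    (forall j x, (L : set G) x -> P j g x = g x) ->
    (forall e : R, 0 < e -> \forall n \near \oo,
      forall x, (L : set G) x -> `|iter n T u x - g x| <= (e%:C)%C) ->
    g 1%g = nu u) ->
    convol_pow mu n @[n --> \oo] --> nu.
  move=> nuP; apply/cmeas_cvgP => u; have [g Pg ug] := limit u.
  rewrite -(nuP u g Pg ug); apply: complex_cvg_le => e /ug.
  by apply: filterS => n /(_ _ L1); rewrite -convol_powE.
have equi (g : C0 R G) : (forall j x, (L : set G) x -> P j g x = g x) ->
    forall j x k, (L : set G) x -> (K j : set G) k ->
    g (x * k)%g * rho j k = g x.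
  move=> Pg j x k Lx Kk; rewrite -(Pg j x)// -(Pg j (x * k)%g).
    exact: char_op_equivariant.
  by apply: LM => //; exact: (KL j).
have cvg_ext (chi : mchar R L) : extends chi ->
    convol_pow mu n @[n --> \oo] --> char_meas mL chi.
  move=> ext; apply: cvg1 => u g Pg ug.
  pose Q := convol_fun (char_meas mL chi).
  rewrite -convol_fun_at1.
  have Tid (v : C0 R G) : (forall j x, (L : set G) x -> P j v x = v x) ->
      forall x, (L : set G) x -> T v x = v x.
    by move=> Pv; apply: (char_prod_id KL) => j _; exact: Pv.
  apply: (iter_limit_char T_le T_energy) => //.
  - have [sH cH] := equivariant_subgroup chi g.
    have LH := genP _ sH cH.
    move=> x Lx; apply: char_op_id => k Lk.
    have [|_ /(_ _ Lx)//] := LH _ k Lk.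
    move=> j h Kh; split=> [|y Ly]; first exact: (KL j).
    by rewrite /= (ext _ _ Kh) equi.
  - exact: Tid.
  (* [Q u] is equivariant for [chi] under [L], hence for each [rho j] under [K j], where the two
     characters agree. *)
  - apply: Tid => j x Lx; apply: char_op_id => k Kk.
    by rewrite -(ext _ _ Kk) char_op_equivariant//; exact: (KL j).
have cvg_no : ~ (exists chi : mchar R L, extends chi) ->
    convol_pow mu n @[n --> \oo] --> (zerom : cmeas R G).
  move=> noext; apply: cvg1 => u g Pg _; apply/eqP; apply: contraT => g1.
  have [sH cH] := proportional_subgroup L g1.
  have gL h : (L : set G) h -> nsq (g h) = nsq (g 1%g) /\
      forall x, (L : set G) x -> g (x * h)%g * g 1%g = g h * g x.
    have LH := genP _ sH cH.
    move=> Lh; have [|_ //] := LH _ h Lh.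
    move=> j k Kk; have Lk := KL j k Kk.
    (* So right translation by [k] scales [g] by the inverse of [rho j k], a number of modulus one:
       [K j] lies in the subgroup of [proportional_subgroup]. *)
    have gk : g k * rho j k = g 1%g by rewrite -{1}[k]mul1g equi.
    split=> //; split=> [|x Lx].
      by rewrite -gk nsqM (nsq_norm1 (mchar_norm (rho j) Kk)) mulr1.
    by rewrite -gk mulrCA equi.
  have [chi chiE] := mchar_of_proportional g1 gL.
  case: noext; exists chi => j k Kk; rewrite chiE.
  have [_ _ KV] := csubgroup_subgroup (K j).
  (* Equivariance at [k^-1] reads [g 1 * rho j k = g (k^-1)], which is the required value of
     [chi]. *)
  have := equi g Pg j (k^-1)%g k (LV _ (KL j k Kk)) Kk.
  by rewrite mulVg => <-; rewrite mulrAC divff// mul1r.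
split=> //.
have [[chi ext]|noext] := pselect (exists chi : mchar R L, extends chi).
  by exists (char_meas mL chi); exact: cvg_ext.
by exists zerom; exact: cvg_no.
Qed.
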